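(* Let $g \in L^\infty(\mathbb{T})\setminus\{0\}$ be such that $\ker T_g \neq \{0\}$. Then $\ker T_g$ has a maximal function; that is, there exists $f_+ \in H^2\setminus\{0\}$ such that $\ker T_g = K_{\min}(f_+)$.
   Context: $\mathbb{D}$ is the open unit disc and $\mathbb{T}$ the unit circle. $H^2=H^2(\mathbb{D})$ is the Hardy space, regarded via non-tangential boundary values as a closed subspace of $L^2(\mathbb{T})$. For $g\in L^\infty(\mathbb{T})$, the Toeplitz operator $T_g:H^2\to H^2$ is $T_g f = P_{H^2}(g f)$, where $P_{H^2}$ is the orthogonal projection of $L^2(\mathbb{T})$ onto $H^2$. A Toeplitz kernel is a subspace of $H^2$ of the form $\ker T_g$ with $g\in L^\infty(\mathbb{T})$. For $f_+\in H^2\setminus\{0\}$, $K_{\min}(f_+)$ denotes the minimal Toeplitz kernel containing $f_+$, i.e. the (unique) Toeplitz kernel that contains $f_+$ and is contained in every Toeplitz kernel $K$ with $f_+\in K$. It is known to exist, and if $f_+ = I O_+$ is the inner–outer factorization of $f_+$ then $K_{\min}(f_+)=\ker T_{\bar z\, \overline{I}\, \overline{O_+}/O_+}$. If a Toeplitz kernel $K$ equals $K_{\min}(f_+)$, then $f_+$ is called a maximal function (or maximal vector) for $K$. *)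

(* Defs.v *)
From mathcomp Require Import all_boot all_order all_algebra.
From mathcomp Require Import complex.
From mathcomp Require Import all_classical all_reals all_analysis.

Set Implicit Arguments.
Unset Strict Implicit.
Unset Printing Implicit Defensive.

Import Order.TTheory GRing.Theory Num.Theory.
Import numFieldNormedType.Exports.

Local Open Scope classical_set_scope.
Local Open Scope ring_scope.

(* The circle is parametrized by t |-> cos t + i sin t on [0, 2 pi], and a
   function on it is represented by f : R -> R[i].  Values of f outside
   [0, 2 pi] carry no mass for [circle_prob], so they are irrelevant.
   Elements of L^p are represented by functions, not by classes: all the
   subspaces of L^2 below are sets of measurable functions that are closed
   under almost everywhere equality, so that equality and inclusion of these
   sets are equality and inclusion of the subspaces. *)

Definition expi (R : realType) (t : R) : R[i] := Complex (cos t) (sin t).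

Lemma two_pi_gt0 (R : realType) : (0 : R) < 2 * pi.
Proof. by rewrite mulr_gt0// pi_gt0. Qed.

(* Normalized arc length. *)
Definition circle_prob (R : realType) : probability (measurableTypeR R) R :=
  uniform_prob (two_pi_gt0 R).

Definition cLfun (R : realType) (p : \bar R) : set (R -> R[i]) :=
  [set f | (fun t => complex.Re (f t)) \in Lfun (circle_prob R) p /\
           (fun t => complex.Im (f t)) \in Lfun (circle_prob R) p].

Definition L2 (R : realType) : set (R -> R[i]) := cLfun 2%:E.

Definition Linfty (R : realType) : set (R -> R[i]) := cLfun +oo%E.

Definition ae_zero (R : realType) (f : R -> R[i]) : Prop :=
  {ae circle_prob R, forall t, f t = 0}.

Definition cintegral (R : realType) (f : R -> R[i]) : R[i] :=
  Complex (\int[circle_prob R]_t complex.Re (f t))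
          (\int[circle_prob R]_t complex.Im (f t)).

Definition inner (R : realType) (u v : R -> R[i]) : R[i] :=
  cintegral (fun t => u t * (v t)^*).

(* The copy R[i]^o of R[i] carries the topology given by the modulus. *)
Definition analytic_disc (R : realType) (F : R[i]^o -> R[i]^o) : Prop :=
  exists a : nat -> R[i]^o, forall z : R[i]^o, `|z| < 1 ->
    series (fun n => a n * z ^+ n) n @[n --> \oo] --> F z.

Definition sqnormc (R : realType) (z : R[i]) : R :=
  complex.Re z ^+ 2 + complex.Im z ^+ 2.

Definition hardy2_disc (R : realType) (F : R[i]^o -> R[i]^o) : Prop :=
  analytic_disc F /\
  exists M : R, forall r : R, 0 < r < 1 ->
    (\int[circle_prob R]_t (sqnormc (F ((r%:C)%C * expi t)))%:E <= M%:E)%E.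

(* The comparison takes place in R[i]; both sides are real, and for
   0 < alpha it forces `|z| < 1. *)
Definition stolz (R : realType) (alpha : R) (zeta : R[i]^o) : set R[i]^o :=
  [set z | `|z - zeta| < (alpha%:C)%C * (1 - `|z|)].

Definition nontangential_limit (R : realType) (F : R[i]^o -> R[i]^o)
    (zeta w : R[i]^o) : Prop :=
  forall alpha : R, 1 < alpha ->
    F z @[z --> within (stolz alpha zeta) (nbhs zeta)] --> w.

(* H^2 as a subspace of L^2 of the circle. *)
Definition H2 (R : realType) : set (R -> R[i]) :=
  [set f | L2 f /\ exists F : R[i]^o -> R[i]^o, hardy2_disc F /\
     {ae circle_prob R, forall t, nontangential_limit F (expi t) (f t)}].

(* A representative of the orthogonal projection of u in L^2 onto H^2: it
   exists because H^2 is closed, and is unique up to a.e. equality. *)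
Definition proj_H2 (R : realType) (u : R -> R[i]) : R -> R[i] :=
  xget (fun=> 0)
    [set h | H2 h /\ forall k, H2 k -> inner (fun t => u t - h t) k = 0].

Definition toeplitz (R : realType) (g f : R -> R[i]) : R -> R[i] :=
  proj_H2 (fun t => g t * f t).

Definition ker_toeplitz (R : realType) (g : R -> R[i]) : set (R -> R[i]) :=
  [set f | H2 f /\ ae_zero (toeplitz g f)].

(* The subspace {0} of L^2. *)
Definition zero_space (R : realType) : set (R -> R[i]) :=
  [set f | L2 f /\ ae_zero f].

Definition is_toeplitz_kernel (R : realType) (K : set (R -> R[i])) : Prop :=
  exists2 g : R -> R[i], Linfty g & K = ker_toeplitz g.

(* is_Kmin f K means K = K_min(f). *)
Definition is_Kmin (R : realType) (f : R -> R[i]) (K : set (R -> R[i])) :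
    Prop :=
  [/\ is_toeplitz_kernel K, K f &
      forall K', is_toeplitz_kernel K' -> K' f -> K `<=` K'].

(* Main.v *)
(** Write [f] in [ker T_g] as [g f = conj (z h)] with [h] in [H^2]. If [h = J O]
    with [J] inner and [O] outer, then [J f] is still in [ker T_g], and
    [g (J f) = conj (z O)]. This makes [J f] maximal: if [g' (J f) = conj (z h')]
    and [g f1 = conj (z h1)], then [phi = conj (z g' f1)] satisfies
    [phi O = h' h1], and [phi] is in [H^2] because [O] is outer, i.e. [1] is a
    limit of [q_n O] with [q_n] polynomials; so [f1] is in [ker T_g'].
    The inner factor [J] is the normalized component of [h] orthogonal to the
    span of [z^n h], [n > 0].

    [H^2] is identified with the functions of [L^2] whose negative Fourier
    coefficients vanish: a function with this property is the nontangential limit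
    of its Poisson integral at its Lebesgue points, and conversely the dilates of
    a function of the Hardy space of the disc converge in mean to its boundary
    function. *)

Require Import Defs.
From mathcomp Require Import all_boot all_order all_algebra.
From mathcomp Require Import complex.
From mathcomp Require Import all_classical all_reals all_analysis.
From mathcomp Require Import measurable_realfun ess_sup_inf.
From mathcomp Require Import ring lra.

Set Implicit Arguments.
Unset Strict Implicit.
Unset Printing Implicit Defensive.

Import Order.TTheory GRing.Theory Num.Theory.
Import numFieldNormedType.Exports.

Local Open Scope classical_set_scope.
Local Open Scope ring_scope.

Local Notation Re := (@complex.Re _).
Local Notation Im := (@complex.Im _).
Local Notation normc := (@Normc.normc _).
Local Notation sqnormc := (@Defs.sqnormc _).

(** * Complex-valued integrable functions *)

Section modulus.
Context {R : realType}.
Implicit Types (x y : R[i]) (r : R).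

(** Passing from [f] to [J f] is forced by the quotient: with [f] itself the identity would read
    [phi J O = h' h1], and the inner factor [J] cannot be cancelled inside [H^2]. After the change
    [O = conj (z g J f)], so [phi O = h' h1] is a mere regrouping of factors under the conjugation.
    The obstacle is that products such as [h' h1] are only integrable. They are therefore never
    placed in a space: analyticity is tested on Fourier coefficients of negative index, and density
    of the polynomials carries the vanishing of these coefficients from the factors to the product.
    Cyclicity is the form of being outer that fits this method. The factorization needs [h] nonzero,
    i.e. [g f] nonzero; this holds because a nonzero function of [H^2] cannot vanish on a set of
    positive measure, which is itself read off from its factorization. Uniqueness of Fourier
    coefficients is required for integrable functions, since it is applied to the squared modulus of
    the future [J]; it comes from the boundary limits of Poisson integrals, and it also gives the
    density of polynomials. *)

Lemma cReD x y : Re (x + y) = Re x + Re y. Proof. by case: x; case: y. Qed.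
Lemma cImD x y : Im (x + y) = Im x + Im y. Proof. by case: x; case: y. Qed.
Lemma cReN x : Re (- x) = - Re x. Proof. by case: x. Qed.
Lemma cImN x : Im (- x) = - Im x. Proof. by case: x. Qed.
Lemma cReM x y : Re (x * y) = Re x * Re y - Im x * Im y.
Proof. by case: x; case: y. Qed.
Lemma cImM x y : Im (x * y) = Re x * Im y + Im x * Re y.
Proof. by case: x; case: y. Qed.
Lemma cReJ x : Re (x^*) = Re x. Proof. by case: x. Qed.
Lemma cImJ x : Im (x^*) = - Im x. Proof. by case: x. Qed.

Lemma complex_ext x y : Re x = Re y -> Im x = Im y -> x = y.
Proof. by case: x => a b; case: y => c d /= -> ->. Qed.

Lemma sqnormc_ge0 x : 0 <= sqnormc x.
Proof. by rewrite /Defs.sqnormc addr_ge0// sqr_ge0. Qed.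

Lemma normc_ge0 x : 0 <= normc x.
Proof. by case: x => a b; rewrite /= sqrtr_ge0. Qed.

Lemma sqr_normcE x : normc x ^+ 2 = sqnormc x.
Proof. by case: x => a b; rewrite /= sqr_sqrtr// addr_ge0// sqr_ge0. Qed.

Lemma sqnormcM x y : sqnormc (x * y) = sqnormc x * sqnormc y.
Proof. by rewrite -!sqr_normcE Normc.normcM exprMn. Qed.

Lemma sqnormcJ x : sqnormc (x^*) = sqnormc x.
Proof. by rewrite /Defs.sqnormc cReJ cImJ sqrrN. Qed.

Lemma normcJE x : normc (x^*) = normc x.
Proof. by case: x => a b /=; rewrite sqrrN. Qed.

Lemma normcNE x : normc (- x) = normc x.
Proof. by case: x => a b /=; rewrite !sqrrN. Qed.

Lemma sqnormcN x : sqnormc (- x) = sqnormc x.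
Proof. by rewrite -!sqr_normcE normcNE. Qed.

Lemma ler_normcD x y : normc (x + y) <= normc x + normc y.
Proof. exact: le_normcD. Qed.

Lemma ler_normcB x y : normc (x - y) <= normc x + normc y.
Proof. by rewrite (le_trans (ler_normcD _ _))// normcNE. Qed.

Lemma normc_distC x y : normc (x - y) = normc (y - x).
Proof. by rewrite -normcNE opprB. Qed.

Lemma normcX x n : normc (x ^+ n) = normc x ^+ n.
Proof.
elim: n => [|n IH]; first by rewrite !expr0 Normc.normc1.
by rewrite !exprS Normc.normcM IH.
Qed.

Lemma normc_real r : normc r%:C%C = `|r|.
Proof. by rewrite /= expr0n/= addr0 sqrtr_sqr. Qed.

Lemma normr_Re_le x : `|Re x| <= normc x.
Proof.
rewrite -ler_sqr ?nnegrE ?normc_ge0// sqr_normcE /Defs.sqnormc real_normK ?num_real//.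
by rewrite lerDl sqr_ge0.
Qed.

Lemma normr_Im_le x : `|Im x| <= normc x.
Proof.
rewrite -ler_sqr ?nnegrE ?normc_ge0// sqr_normcE /Defs.sqnormc real_normK ?num_real//.
by rewrite lerDr sqr_ge0.
Qed.

Lemma normc_le_ReIm x : normc x <= `|Re x| + `|Im x|.
Proof.
rewrite -ler_sqr ?nnegrE ?addr_ge0 ?normc_ge0// sqr_normcE /Defs.sqnormc sqrrD.
rewrite !real_normK ?num_real// addrAC lerDl mulrn_wge0// mulr_ge0//.
Qed.

Lemma normc_eq0 x : (normc x == 0) = (x == 0).
Proof.
by apply/eqP/eqP => [/Normc.eq0_normc//|->]; rewrite Normc.normc0.
Qed.

Lemma sqnormc_eq0 x : (sqnormc x == 0) = (x == 0).
Proof. by rewrite -sqr_normcE sqrf_eq0 normc_eq0. Qed.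

Lemma mulcJE x : x * x^* = (sqnormc x)%:C%C.
Proof. by case: x => a b; apply: complex_ext; rewrite /Defs.sqnormc /=; ring. Qed.

(** Completing the square. The free weight [r] does the work of the Cauchy-Schwarz inequality later:
    a small error in one factor is balanced against a mere bound on the other. *)
Lemma normc_mul_le x y r : 0 < r ->
  normc (x * y) <= r * sqnormc x + r^-1 * sqnormc y.
Proof.
move=> r0; rewrite Normc.normcM -!sqr_normcE.
move: (normc x) (normc y) (normc_ge0 x) (normc_ge0 y) => a b a0 b0.
have E : r * a ^+ 2 + r^-1 * b ^+ 2 - a * b =
    r^-1 * ((r * a - b / 2) ^+ 2 + 3 / 4 * b ^+ 2).
  by field; rewrite gt_eqF.
rewrite -subr_ge0 E mulr_ge0//; first by rewrite invr_ge0 ltW.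
by rewrite addr_ge0 ?sqr_ge0// mulr_ge0 ?sqr_ge0//; lra.
Qed.

Lemma sqnormcD_le x y : sqnormc (x + y) <= 2 * sqnormc x + 2 * sqnormc y.
Proof.
rewrite /Defs.sqnormc cReD cImD; have := sqr_ge0 (Re x - Re y).
have := sqr_ge0 (Im x - Im y); nra.
Qed.

Lemma parallelogramc x y :
  sqnormc (x - y) = 2 * sqnormc x + 2 * sqnormc y - sqnormc (x + y).
Proof. by rewrite /Defs.sqnormc !cReD !cImD cReN cImN; ring. Qed.

End modulus.

Section complex_integral.
Context {d} {T : measurableType d} {R : realType} (P : probability T R).
Implicit Types (u v : T -> R) (f g h : T -> R[i]) (c : R[i]).

Definition rint u := P.-integrable setT (EFin \o u).
Definition cmf f := measurable_fun setT (Re \o f) /\ measurable_fun setT (Im \o f).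
Definition cL1 f := rint (Re \o f) /\ rint (Im \o f).
Definition cL2 f := cmf f /\ rint (sqnormc \o f).
Definition cint f : R[i] := Complex (\int[P]_t Re (f t)) (\int[P]_t Im (f t)).
Definition nsq f : R := \int[P]_t sqnormc (f t).

Lemma rint_meas u : rint u -> measurable_fun setT u.
Proof. by move=> /integrableP[/measurable_EFinP]. Qed.

Lemma rint_le u v : measurable_fun setT u -> (forall t, `|u t| <= v t) ->
  rint v -> rint u.
Proof.
move=> mu uv; apply: le_integrable => //; first exact/measurable_EFinP.
move=> t _ /=; rewrite lee_fin (le_trans (uv t))//.
exact: ler_norm.
Qed.

Lemma rintD u v : rint u -> rint v -> rint (fun t => u t + v t).
Proof. by move=> ru rv; exact (integrableD measurableT ru rv). Qed.

Lemma rintB u v : rint u -> rint v -> rint (fun t => u t - v t).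
Proof. by move=> ru rv; exact (integrableB measurableT ru rv). Qed.

Lemma rintZ r u : rint u -> rint (fun t => r * u t).
Proof. by move=> ru; exact (integrableZl measurableT r ru). Qed.

Lemma rint_cst r : rint (fun=> r).
Proof. exact: finite_measure_integrable_cst. Qed.

Lemma rint_norm u : rint u -> rint (fun t => `|u t|).
Proof. exact: integrable_norm. Qed.

Lemma rintegral_ae_eq u v : measurable_fun setT u -> measurable_fun setT v ->
  {ae P, forall t, u t = v t} -> \int[P]_t u t = \int[P]_t v t.
Proof.
move=> mu mv uv; rewrite /Rintegral; congr fine; apply: ae_eq_integral => //.
- exact/measurable_EFinP.
- exact/measurable_EFinP.
- by apply: filterS uv => t /= -> _.
Qed.

Lemma rint_ae_eq u v : measurable_fun setT v ->
  {ae P, forall t, u t = v t} -> rint u -> rint v.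
Proof.
move=> mv uv ru; apply/integrableP; split; first exact/measurable_EFinP.
move/integrableP: (ru) => [mu]; apply: le_lt_trans.
rewrite le_eqVlt; apply/orP; left; apply/eqP.
apply: ae_eq_integral => //.
- by apply: measurableT_comp => //; exact/measurable_EFinP.
- exact: measurableT_comp.
- by apply: filterS uv => t /= -> _.
Qed.

Lemma rint_EFin u : rint u -> (\int[P]_t (u t)%:E)%E = (\int[P]_t u t)%:E.
Proof. by move=> ru; rewrite /Rintegral fineK//; exact: integrable_fin_num. Qed.

Lemma rintegral_cst r : \int[P]_t r = r.
Proof.
rewrite Rintegral_cst//.
rewrite -[RHS]mulr1; congr (_ * _); rewrite -[1]/(fine 1%:E); congr fine.
exact: probability_setT.
Qed.

Lemma rintegral_le u v : rint u -> rint v -> (forall t, u t <= v t) ->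
  \int[P]_t u t <= \int[P]_t v t.
Proof. by move=> ru rv uv; apply: le_Rintegral. Qed.

Lemma rintegral_eq0_ae u : rint u -> (forall t, 0 <= u t) ->
  \int[P]_t u t = 0 -> {ae P, forall t, u t = 0}.
Proof.
move=> ru u0 u00; have := rint_EFin ru; rewrite u00 => iu.
have mu : measurable_fun setT (EFin \o u) by apply/measurable_EFinP/rint_meas.
have [+ _] := ae_eq_integral_abs P measurableT mu.
under eq_integral do rewrite /= ger0_norm//.
by move=> /(_ iu); apply: filterS => t /(_ I)[].
Qed.

Lemma cmf_cst c : cmf (fun=> c). Proof. by split; exact: measurable_cst. Qed.

Lemma cmfD f g : cmf f -> cmf g -> cmf (fun t => f t + g t).
Proof.
move=> [f1 f2] [g1 g2]; split.
- rewrite (_ : _ \o _ = (Re \o f) \+ (Re \o g)); first exact: measurable_funD.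
  by apply/funext => t /=; rewrite cReD.
- rewrite (_ : _ \o _ = (Im \o f) \+ (Im \o g)); first exact: measurable_funD.
  by apply/funext => t /=; rewrite cImD.
Qed.

Lemma cmfN f : cmf f -> cmf (fun t => - f t).
Proof.
move=> [f1 f2]; split.
- rewrite (_ : _ \o _ = \- (Re \o f)); first exact: measurable_funN.
  by apply/funext => t /=; rewrite cReN.
- rewrite (_ : _ \o _ = \- (Im \o f)); first exact: measurable_funN.
  by apply/funext => t /=; rewrite cImN.
Qed.

Lemma cmfB f g : cmf f -> cmf g -> cmf (fun t => f t - g t).
Proof. by move=> mf mg; apply: cmfD => //; exact: cmfN. Qed.

Lemma cmfM f g : cmf f -> cmf g -> cmf (fun t => f t * g t).
Proof.
move=> [f1 f2] [g1 g2]; split.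
- rewrite (_ : _ \o _ = ((Re \o f) \* (Re \o g)) \- ((Im \o f) \* (Im \o g))).
    by apply: measurable_funB; exact: measurable_funM.
  by apply/funext => t /=; rewrite cReM.
- rewrite (_ : _ \o _ = ((Re \o f) \* (Im \o g)) \+ ((Im \o f) \* (Re \o g))).
    by apply: measurable_funD; exact: measurable_funM.
  by apply/funext => t /=; rewrite cImM.
Qed.

Lemma cmfJ f : cmf f -> cmf (fun t => (f t)^*).
Proof.
move=> [f1 f2]; split.
- rewrite (_ : _ \o _ = Re \o f)//.
  by apply/funext => t /=; rewrite cReJ.
- rewrite (_ : _ \o _ = \- (Im \o f)); first exact: measurable_funN.
  by apply/funext => t /=; rewrite cImJ.
Qed.

Lemma cmfX f n : cmf f -> cmf (fun t => f t ^+ n).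
Proof.
move=> mf; elim: n => [|n IH]; first exact: cmf_cst.
rewrite (_ : (fun _ => _) = (fun t => f t * f t ^+ n)); first exact: cmfM.
by apply/funext => t; rewrite exprS.
Qed.

Lemma measurable_sqnormc f : cmf f -> measurable_fun setT (sqnormc \o f).
Proof.
by move=> [f1 f2]; apply: measurable_funD; exact: measurable_funX.
Qed.

Lemma measurable_normc f : cmf f -> measurable_fun setT (normc \o f).
Proof.
move=> mf; have -> : normc \o f = (@powR R ^~ 2^-1) \o (sqnormc \o f).
  by apply/funext => t /=; rewrite -sqr_normcE -powR_mulrn ?normc_ge0//
    -powRrM mulfV ?powRr1 ?normc_ge0// pnatr_eq0.
apply: (measurableT_comp (measurable_powR _)).
exact: measurable_sqnormc.
Qed.

Lemma cL1_meas f : cL1 f -> cmf f.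
Proof. by move=> [/rint_meas ? /rint_meas ?]. Qed.

Lemma cL1P f : cmf f -> rint (normc \o f) -> cL1 f.
Proof.
move=> [f1 f2] rf; split.
- by apply: (rint_le f1) rf => t; exact: normr_Re_le.
- by apply: (rint_le f2) rf => t; exact: normr_Im_le.
Qed.

Lemma cL1_normc f : cL1 f -> rint (normc \o f).
Proof.
move=> /[dup]/cL1_meas mf [f1 f2].
apply: (rint_le (measurable_normc mf)); last first.
  by apply: rintD; apply: rint_norm; [exact: f1|exact: f2].
by move=> t /=; rewrite ger0_norm ?normc_ge0// normc_le_ReIm.
Qed.

Lemma cL1_le f u : cmf f -> (forall t, normc (f t) <= u t) -> rint u -> cL1 f.
Proof.
move=> mf fu ru; apply: cL1P => //; apply: (rint_le (measurable_normc mf)) ru => t.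
by rewrite /= ger0_norm ?normc_ge0.
Qed.

Lemma cL1N f : cL1 f -> cL1 (fun t => - f t).
Proof.
move=> lf; apply: (@cL1_le _ (normc \o f)).
- by apply: cmfN; exact: cL1_meas.
- by move=> t; rewrite normcNE.
- exact: cL1_normc.
Qed.

Lemma cL1_bounded f h M : cmf h -> (forall t, normc (h t) <= M) ->
  cL1 f -> cL1 (fun t => f t * h t).
Proof.
move=> mh hM lf; apply: (@cL1_le _ (fun t => M * normc (f t))).
- by apply: cmfM => //; exact: cL1_meas.
- by move=> t; rewrite Normc.normcM mulrC ler_wpM2r// normc_ge0.
- by apply: rintZ; exact: cL1_normc.
Qed.

Lemma cL1Z c f : cL1 f -> cL1 (fun t => c * f t).
Proof.
move=> lf; rewrite (_ : (fun _ => _) = (fun t => f t * c)).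
  by apply: (@cL1_bounded _ _ (normc c)) => //; exact: cmf_cst.
by apply/funext => t; rewrite mulrC.
Qed.

Lemma cL1J f : cL1 f -> cL1 (fun t => (f t)^*).
Proof.
move=> lf; apply: (@cL1_le _ (normc \o f)).
- by apply: cmfJ; exact: cL1_meas.
- by move=> t; rewrite normcJE.
- exact: cL1_normc.
Qed.

Lemma cL1_cst c : cL1 (fun=> c).
Proof. by split; exact: rint_cst. Qed.

Lemma cint_cst c : cint (fun=> c) = c.
Proof. by case: c => a b; rewrite /cint !rintegral_cst. Qed.

Lemma cintD f g : cL1 f -> cL1 g ->
  cint (fun t => f t + g t) = cint f + cint g.
Proof.
move=> [f1 f2] [g1 g2]; apply: complex_ext; rewrite ?cReD ?cImD /=.
- by rewrite -RintegralD//; apply: eq_Rintegral => t _; rewrite cReD.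
- by rewrite -RintegralD//; apply: eq_Rintegral => t _; rewrite cImD.
Qed.

Lemma cintZ c f : cL1 f -> cint (fun t => c * f t) = c * cint f.
Proof.
move=> [f1 f2]; apply: complex_ext; rewrite ?cReM ?cImM /=.
- rewrite -!RintegralZl// -RintegralB//; [|exact: rintZ..].
  by apply: eq_Rintegral => t _; rewrite cReM.
- rewrite -!RintegralZl// -RintegralD//; [|exact: rintZ..].
  by apply: eq_Rintegral => t _; rewrite cImM.
Qed.

Lemma cintN f : cL1 f -> cint (fun t => - f t) = - cint f.
Proof.
move=> lf; rewrite -mulN1r -cintZ//; congr cint.
by apply/funext => t; rewrite mulN1r.
Qed.

Lemma cintB f g : cL1 f -> cL1 g ->
  cint (fun t => f t - g t) = cint f - cint g.
Proof. by move=> lf lg; rewrite cintD ?cintN//; exact: cL1N. Qed.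

Lemma cintJ f : cL1 f -> cint (fun t => (f t)^*) = (cint f)^*.
Proof.
move=> [f1 f2]; apply: complex_ext; rewrite ?cReJ ?cImJ /=.
  by apply: eq_Rintegral => t _; rewrite cReJ.
rewrite -mulN1r -RintegralZl//.
by apply: eq_Rintegral => t _; rewrite cImJ mulN1r.
Qed.

Lemma cint_ae_eq f g : cmf f -> cmf g -> {ae P, forall t, f t = g t} ->
  cint f = cint g.
Proof.
move=> [f1 f2] [g1 g2] fg; congr Complex; apply: rintegral_ae_eq => //;
  by apply: filterS fg => t ->.
Qed.

(** Rotation by the conjugate of [w = cint f] makes the integral real: [|w|^2] is the integral of
    [Re (w^* f)], which is at most [|w| |f|] pointwise. *)
Lemma normc_cint_le f : cL1 f -> normc (cint f) <= \int[P]_t normc (f t).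
Proof.
move=> lf; set w := cint f.
have [w0|w0] := eqVneq (normc w) 0.
  by rewrite w0; apply: Rintegral_ge0 => t _; exact: normc_ge0.
have wp : 0 < normc w by rewrite lt_neqAle eq_sym w0 normc_ge0.
rewrite -(ler_pM2l wp) -RintegralZl//; last exact: cL1_normc.
have -> : normc w * normc w = Re (cint (fun t => w^* * f t)).
  by rewrite cintZ// -/w [w^* * w]mulrC mulcJE -expr2 sqr_normcE.
have l2 : cL1 (fun t => w^* * f t) by exact: cL1Z.
apply: rintegral_le; [by case: l2|by apply: rintZ; exact: cL1_normc|].
move=> t; rewrite (le_trans (ler_norm _))// (le_trans (normr_Re_le _))//.
by rewrite Normc.normcM normcJE.
Qed.

Lemma cL2_meas f : cL2 f -> cmf f. Proof. by case. Qed.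

Lemma cL2_le f u : cmf f -> (forall t, sqnormc (f t) <= u t) -> rint u -> cL2 f.
Proof.
move=> mf fu ru; split => //; apply: (rint_le (measurable_sqnormc mf)) ru => t.
by rewrite /= ger0_norm ?sqnormc_ge0.
Qed.

Lemma cL2D f g : cL2 f -> cL2 g -> cL2 (fun t => f t + g t).
Proof.
move=> [mf rf] [mg rg]; apply: (@cL2_le _ _ _ (fun t => sqnormcD_le (f t) (g t))).
  exact: cmfD.
by apply: rintD; exact: rintZ.
Qed.

Lemma cL2N f : cL2 f -> cL2 (fun t => - f t).
Proof.
move=> [mf rf]; apply: (@cL2_le _ (sqnormc \o f)) => //; first exact: cmfN.
by move=> t; rewrite sqnormcN.
Qed.

Lemma cL2B f g : cL2 f -> cL2 g -> cL2 (fun t => f t - g t).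
Proof. by move=> lf lg; apply: cL2D => //; exact: cL2N. Qed.

Lemma cL2J f : cL2 f -> cL2 (fun t => (f t)^*).
Proof.
move=> [mf rf]; apply: (@cL2_le _ (sqnormc \o f)) => //; first exact: cmfJ.
by move=> t; rewrite sqnormcJ.
Qed.

Lemma cL2_bounded f h M : cmf h -> (forall t, normc (h t) <= M) ->
  cL2 f -> cL2 (fun t => h t * f t).
Proof.
move=> mh hM [mf rf]; apply: (@cL2_le _ (fun t => M ^+ 2 * sqnormc (f t))).
- exact: cmfM.
- move=> t; rewrite sqnormcM ler_wpM2r ?sqnormc_ge0// -sqr_normcE.
  by rewrite ler_pXn2r ?nnegrE ?normc_ge0// (le_trans _ (hM t))// normc_ge0.
- exact: rintZ.
Qed.

Lemma cL2Z c f : cL2 f -> cL2 (fun t => c * f t).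
Proof. by apply: (@cL2_bounded _ _ (normc c)) => //; exact: cmf_cst. Qed.

Lemma cL2_cst c : cL2 (fun=> c).
Proof. by split; [exact: cmf_cst|exact: rint_cst]. Qed.

Lemma cL2_mul f g : cL2 f -> cL2 g -> cL1 (fun t => f t * g t).
Proof.
move=> [mf rf] [mg rg].
apply: (@cL1_le _ _ _ (fun t => normc_mul_le (f t) (g t) ltr01)).
  exact: cmfM.
by apply: rintD; exact: rintZ.
Qed.

Lemma cL2_cL1 f : cL2 f -> cL1 f.
Proof.
move=> lf; rewrite (_ : f = (fun t => f t * 1)); first exact: cL2_mul lf (cL2_cst 1).
by apply/funext => t; rewrite mulr1.
Qed.

Lemma cL2_ae_eq f g : cmf g -> {ae P, forall t, f t = g t} -> cL2 f -> cL2 g.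
Proof.
move=> mg fg [mf rf]; split => //; apply: rint_ae_eq rf.
- exact: measurable_sqnormc.
- by apply: filterS fg => t /= ->.
Qed.

Lemma nsq_ge0 f : 0 <= nsq f.
Proof. by apply: Rintegral_ge0 => t _; exact: sqnormc_ge0. Qed.

Lemma nsq_ae_eq f g : cmf f -> cmf g -> {ae P, forall t, f t = g t} ->
  nsq f = nsq g.
Proof.
move=> mf mg fg; apply: rintegral_ae_eq; [exact: measurable_sqnormc..|].
by apply: filterS fg => t ->.
Qed.

Lemma nsq_eq0 f : cL2 f -> nsq f = 0 -> {ae P, forall t, f t = 0}.
Proof.
move=> [mf rf] f0; have := rintegral_eq0_ae rf (fun t => sqnormc_ge0 _) f0.
by apply: filterS => t /eqP /=; rewrite sqnormc_eq0 => /eqP.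
Qed.

Lemma nsqN f : nsq (fun t => - f t) = nsq f.
Proof. by apply: eq_Rintegral => t _; rewrite sqnormcN. Qed.

Lemma nsqZ c f : cL2 f -> nsq (fun t => c * f t) = sqnormc c * nsq f.
Proof.
move=> [_ rf]; rewrite /nsq -RintegralZl//.
by apply: eq_Rintegral => t _; rewrite sqnormcM.
Qed.

Lemma nsq_distC f g : nsq (fun t => f t - g t) = nsq (fun t => g t - f t).
Proof. by rewrite -nsqN; congr nsq; apply/funext => t; rewrite opprB. Qed.

Lemma nsqD_le f g : cL2 f -> cL2 g ->
  nsq (fun t => f t + g t) <= 2 * nsq f + 2 * nsq g.
Proof.
move=> lf lg; have [_ rfg] := cL2D lf lg; case: lf lg => _ rf [_ rg].
rewrite /nsq -!RintegralZl// -RintegralD//; [|exact: rintZ..].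
apply: rintegral_le => //; first by apply: rintD; exact: rintZ.
by move=> t; exact: sqnormcD_le.
Qed.

Lemma parallelogram f g : cL2 f -> cL2 g ->
  nsq (fun t => f t - g t) = 2 * nsq f + 2 * nsq g - nsq (fun t => f t + g t).
Proof.
move=> lf lg; have [_ rfg] := cL2D lf lg; case: lf lg => _ rf [_ rg].
rewrite /nsq -!RintegralZl// -RintegralD//; [|exact: rintZ..].
rewrite -RintegralB//; last by apply: rintD; exact: rintZ.
by apply: eq_Rintegral => t _; rewrite parallelogramc.
Qed.

Lemma cint_mul_le f g r : 0 < r -> cL2 f -> cL2 g ->
  normc (cint (fun t => f t * g t)) <= r * nsq f + r^-1 * nsq g.
Proof.
move=> r0 lf lg; rewrite (le_trans (normc_cint_le (cL2_mul lf lg)))//.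
have ln := cL1_normc (cL2_mul lf lg); case: lf lg => _ rf [_ rg].
rewrite /nsq -!RintegralZl// -RintegralD//; [|exact: rintZ..].
apply: rintegral_le => //; first by apply: rintD; exact: rintZ.
by move=> t; exact: normc_mul_le.
Qed.

(** Continuity of the pairing in its first argument, the tool by which every vanishing coefficient
    below passes to an [L^2] limit. *)
Lemma cvg_cint_mul (F : nat -> T -> R[i]) f g : (forall n, cL2 (F n)) ->
  cL2 f -> cL2 g -> nsq (fun t => F n t - f t) @[n --> \oo] --> 0 ->
  normc (cint (fun t => F n t * g t) - cint (fun t => f t * g t)) @[n --> \oo]
    --> 0.
Proof.
move=> lF lf lg Ff; apply/cvgrPdist_le => e e0.
(* This weight makes [r^-1 * nsq g] at most [e / 2]; adding 1 keeps it positive when [g] is null. *)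
pose r := (2 * (nsq g + 1)) / e.
have r0 : 0 < r by rewrite divr_gt0// mulr_gt0// ltr_wpDl ?nsq_ge0.
have /cvgrPdist_le/(_ (e / (2 * r))) := Ff.
have er0 : 0 < e / (2 * r) by rewrite divr_gt0// mulr_gt0.
move=> /(_ er0); apply: filterS => n; rewrite sub0r normrN ger0_norm ?nsq_ge0//.
move=> h; rewrite sub0r normrN ger0_norm ?normc_ge0//.
rewrite -cintB; [|exact: cL2_mul..].
rewrite (_ : (fun t => _) = (fun t => (F n t - f t) * g t)); last first.
  by apply/funext => t; rewrite mulrBl.
rewrite (le_trans (cint_mul_le r0 _ _))//; first exact: cL2B.
have -> : e = e / 2 + e / 2 by field.
apply: lerD.
  rewrite (le_trans (ler_wpM2l (ltW r0) h))// le_eqVlt; apply/orP; left.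
  by apply/eqP; field; rewrite gt_eqF.
have -> : r^-1 = e / 2 / (nsq g + 1).
  by rewrite /r invf_div -mulrA -invfM.
have N1 : 0 < nsq g + 1 by rewrite ltr_wpDl ?nsq_ge0.
rewrite -(mulrA (e / 2)) -[leRHS]mulr1; apply: ler_wpM2l.
  by rewrite divr_ge0// ltW.
by rewrite mulrC ler_pdivrMr// mul1r lerDl.
Qed.

End complex_integral.

(** * Completeness of L^2 and projections *)

Section completeness.
Context {d} {T : measurableType d} {R : realType} (P : probability T R).
Implicit Types (u v : T -> R) (f g h : T -> R[i]) (c : R[i]).

Lemma rint_fatou (U : nat -> T -> R) u M : (forall n, rint P (U n)) ->
  (forall n t, 0 <= U n t) -> (forall n, \int[P]_t U n t <= M) ->
  measurable_fun setT u -> (forall t, 0 <= u t) ->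
  {ae P, forall t, U n t @[n --> \oo] --> u t} ->
  rint P u /\ \int[P]_t u t <= M.
Proof.
move=> rU U0 UM mu u0 Uu.
have mU n : measurable_fun setT (EFin \o U n).
  by apply/measurable_EFinP; exact: rint_meas (rU n).
have leM : (\int[P]_t (u t)%:E <= M%:E)%E.
  have -> : (\int[P]_t (u t)%:E = \int[P]_t limn_einf (fun n => (U n t)%:E))%E.
    apply: ae_eq_integral => //; first exact/measurable_EFinP.
      (* Measurability of the lower limit is deduced from that of the upper limit through
         negation. *)
      rewrite (_ : (fun t => _) =
          (-%E \o (fun t => limn_esup (fun n => - (U n t)%:E)))%E); last first.
        apply/funext => t; rewrite /= -limn_einfN; congr limn_einf.
        by apply/funext => n /=; rewrite opprK.
      have mo : measurable_fun [set: \bar R] -%E by [].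
      apply: (measurableT_comp mo).
      apply: (measurable_fun_limn_esup (f := fun n t => (- (U n t)%:E)%E)) => n.
      exact: (measurableT_comp mo (mU n)).
    apply: filterS Uu => t Ut _.
    have cU : (U n t)%:E @[n --> \oo] --> (u t)%:E.
      by apply: cvg_EFin; [exact: nearW|exact: Ut].
    by rewrite (cvg_limn_einf_sup cU).1.
  rewrite (le_trans (fatou P measurableT mU _))//.
    by move=> n t _; rewrite lee_fin.
  rewrite limn_einf_lim; apply: lime_le; first exact: is_cvg_einfs.
  apply: nearW => n; apply: (@le_trans _ _ (\int[P]_t (U n t)%:E)%E).
    by apply: ereal_inf_lbound; exists n => //=.
  by rewrite rint_EFin// lee_fin.
have ru : rint P u.
  apply/integrableP; split; first exact/measurable_EFinP.
  rewrite (le_lt_trans _ (ltry M))// (le_trans _ leM)// le_eqVlt.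
  apply/orP; left; apply/eqP; apply: eq_integral => t _ /=.
  by rewrite ger0_norm.
by split => //; rewrite -lee_fin -rint_EFin.
Qed.

(** By monotone convergence the sum of the [D n] has integral at most [B], so it is finite almost
    everywhere. *)
Lemma ae_summable (D : nat -> T -> R) (M : nat -> R) B : (forall n, rint P (D n)) ->
  (forall n t, 0 <= D n t) -> (forall n, \int[P]_t D n t <= M n) ->
  (forall n, series M n <= B) ->
  {ae P, forall t, cvgn (series (fun n => D n t))}.
Proof.
move=> rD D0 DM MB.
have mD n : measurable_fun setT (EFin \o D n).
  by apply/measurable_EFinP; exact: rint_meas (rD n).
have H : (\int[P]_t (\sum_(0 <= n <oo) (D n t)%:E) < +oo)%E.
  rewrite integral_nneseries//; last by move=> n t _; rewrite lee_fin.
  rewrite (@le_lt_trans _ _ B%:E)// ?ltry//.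
  apply: lime_le.
    apply: is_cvg_nneseries => n _ _.
    by apply: integral_ge0 => t _; rewrite lee_fin.
  apply: nearW => n; rewrite (le_trans _ (MB n : (_%:E <= B%:E)%E))//.
  rewrite /series/= -sumEFin; apply: lee_sum => k _.
  by rewrite rint_EFin// lee_fin.
have : P.-integrable setT (fun t => \sum_(0 <= n <oo) (D n t)%:E)%E.
  apply/integrableP; split.
    apply: (@ge0_emeasurable_sum _ _ _ _ (fun n t => (D n t)%:E)).
      by move=> k t _ _; rewrite lee_fin.
    by move=> k _; exact: mD.
  rewrite (le_lt_trans _ H)// le_eqVlt; apply/orP; left; apply/eqP.
  apply: eq_integral => t _; rewrite gee0_abs//.
  by apply: nneseries_ge0 => n _ _; rewrite lee_fin.
move=> /(integrable_ae measurableT); apply: filterS => t /(_ I) ft.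
apply: nondecreasing_is_cvgn.
  by apply: nondecreasing_series => n _ _; exact: D0.
exists (fine (\sum_(0 <= n <oo) (D n t)%:E)%E) => _ [n _ <-].
rewrite -lee_fin fineK// /series/= -sumEFin.
by apply: nneseries_lim_ge => k _ _; rewrite lee_fin.
Qed.

(** The upper limit is defined at every point, so it provides a measurable limit function without
    singling out the set where the sequence converges. *)
Lemma measurable_fine_limn_esup (A : nat -> T -> R) :
  (forall n, measurable_fun setT (A n)) ->
  measurable_fun setT (fun t => fine (limn_esup (fun n => (A n t)%:E))).
Proof.
move=> mA; have mf : measurable_fun [set: \bar R] fine by [].
apply: (measurableT_comp mf).
apply: (measurable_fun_limn_esup (f := fun n t => (A n t)%:E)) => n.
exact/measurable_EFinP.
Qed.

Lemma cvg_fine_limn_esup (a : nat -> R) : cvgn a ->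
  a n @[n --> \oo] --> fine (limn_esup (fun n => (a n)%:E)).
Proof.
move=> ca; have cU : (a n)%:E @[n --> \oo] --> (limn a)%:E.
  by apply: cvg_EFin; [exact: nearW|exact: ca].
by rewrite (cvg_limn_einf_sup cU).2 /=.
Qed.

Lemma summable_diff_cvg (a : nat -> R) (D : nat -> R) :
  (forall n, `|a n.+1 - a n| <= D n) -> cvgn (series D) -> cvgn a.
Proof.
move=> aD cD; have ct : cvgn (series (telescope a)).
  apply: normed_cvg; apply: (series_le_cvg _ _ _ cD) => n /=.
  - exact: normr_ge0.
  - by rewrite (le_trans _ (aD n)).
  - exact: aD.
have -> : a = cst (a 0%N) + series (telescope a).
  by apply/funext => k; rewrite [LHS]eq_sum_telescope.
by apply: is_cvgD ct; exact: is_cvg_cst.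
Qed.

Lemma cvg_sqnormcB (z : R[i]) (a : nat -> R[i]) (x y : R) :
  Re (a n) @[n --> \oo] --> x -> Im (a n) @[n --> \oo] --> y ->
  sqnormc (z - a n) @[n --> \oo] --> sqnormc (z - Complex x y).
Proof.
move=> ax ay; rewrite /Defs.sqnormc.
rewrite (_ : (fun n => _) = (fun n => (Re z - Re (a n)) * (Re z - Re (a n)) +
    (Im z - Im (a n)) * (Im z - Im (a n)))); last first.
  by apply/funext => n; rewrite cReD cImD cReN cImN !expr2.
rewrite cReD cImD cReN cImN /= !expr2.
by apply: cvgD; apply: cvgM; apply: cvgB => //; exact: cvg_cst.
Qed.

Lemma cvg_quarter_pow : (4^-1 : R) ^+ n @[n --> \oo] --> 0.
Proof.
have := @cvg_geometric R 1 4^-1.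
rewrite ger0_norm ?invr_ge0// invf_lt1// ltr1n => /(_ isT).
rewrite (_ : geometric 1 4^-1 = fun n => (4^-1) ^+ n)//.
by apply/funext => n; rewrite /= mul1r.
Qed.

(** Riesz-Fischer for sequences that are already rapidly Cauchy, which is all that minimizing
    sequences need. Consecutive differences are summable almost everywhere, and Fatou's lemma turns
    the bounds on [s n - s m] into bounds on [s n - h]. *)
Lemma cL2_complete (s : nat -> T -> R[i]) : (forall n, cL2 P (s n)) ->
  (forall n m, (n <= m)%N ->
     nsq P (fun t => s n t - s m t) <= (4^-1) ^+ n) ->
  exists2 h, cL2 P h & forall n, nsq P (fun t => s n t - h t) <= (4^-1) ^+ n.
Proof.
move=> ls cs.
pose D n t := normc (s n.+1 t - s n t).
have ld n : cL2 P (fun t => s n.+1 t - s n t) by exact: cL2B.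
have : {ae P, forall t, cvgn (series (fun n => D n t))}.
  (* With weight [2 ^+ n] against the constant 1, the integral of [D n] is at most
     [2^n 4^-n + 2^-n], twice [2^-n]. *)
  apply: (@ae_summable _ (fun n => 2 * (2^-1) ^+ n) (2 * (1 - 2^-1)^-1)) => [n|n t|n|n].
  - exact/cL1_normc/cL2_cL1.
  - exact: normc_ge0.
  - have rs : rint P (fun t => 2 ^+ n * sqnormc (s n.+1 t - s n t) + (2^-1) ^+ n).
      by apply: rintD; [apply: rintZ; have [] := ld n|exact: rint_cst].
    apply: (@le_trans _ _ (\int[P]_t (2 ^+ n * sqnormc (s n.+1 t - s n t) + (2^-1) ^+ n))).
      apply: rintegral_le => //; first exact/cL1_normc/cL2_cL1.
      move=> t; have p2 : 0 < (2 : R) ^+ n by rewrite exprn_gt0.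
      have := normc_mul_le (s n.+1 t - s n t) 1 p2.
      by rewrite mulr1 exprVn -[sqnormc 1]sqr_normcE Normc.normc1 expr1n mulr1.
    rewrite RintegralD//; last 2 first.
    - by apply: rintZ; have [] := ld n.
    - exact: rint_cst.
    rewrite rintegral_cst RintegralZl//; last by have [] := ld n.
    rewrite mulr_natl mulr2n lerD2r.
    have := cs n n.+1 (leqnSn n); rewrite nsq_distC => h.
    rewrite (le_trans (ler_wpM2l _ h))// ?exprn_ge0// -exprMn.
    by rewrite (_ : 2 * 4^-1 = 2^-1 :> R)//; field.
  - rewrite (le_trans (geometric_le_lim n _ _ _))//.
    by rewrite ger0_norm ?invr_ge0// invf_lt1// ltr1n.
move=> sD.
pose h t := Complex (fine (limn_esup (fun n => (Re (s n t))%:E)))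
                    (fine (limn_esup (fun n => (Im (s n t))%:E))).
have mh : cmf h.
  by split; apply: measurable_fine_limn_esup => n; have [[]] := ls n.
have {}sD : {ae P, forall t, forall n,
    sqnormc (s n t - s (n + m)%N t) @[m --> \oo] --> sqnormc (s n t - h t)}.
  apply: filterS sD => t Dt n; apply: (cvg_sqnormcB (a := fun m => s (n + m)%N t)).
  - apply: (@cvg_comp _ _ _ (addn n) (fun m => Re (s m t)) _ _ _ (cvg_addnl n)).
    apply: cvg_fine_limn_esup.
    apply: summable_diff_cvg Dt => k; rewrite -cReN -cReD; exact: normr_Re_le.
  - apply: (@cvg_comp _ _ _ (addn n) (fun m => Im (s m t)) _ _ _ (cvg_addnl n)).
    apply: cvg_fine_limn_esup.
    apply: summable_diff_cvg Dt => k; rewrite -cImN -cImD; exact: normr_Im_le.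
have H n : rint P (fun t => sqnormc (s n t - h t)) /\
    nsq P (fun t => s n t - h t) <= (4^-1) ^+ n.
  apply: (rint_fatou (U := fun m t => sqnormc (s n t - s (n + m)%N t))).
  - by move=> m; have [] := cL2B (ls n) (ls (n + m)%N).
  - by move=> m t; exact: sqnormc_ge0.
  - by move=> m; apply: cs; exact: leq_addr.
  - by apply: measurable_sqnormc; apply: cmfB => //; exact: cL2_meas.
  - by move=> t; exact: sqnormc_ge0.
  - by apply: filterS sD => t /(_ n).
exists h => [|n]; last by have [] := H n.
have -> : h = (fun t => s 0%N t - (s 0%N t - h t)).
  by apply/funext => t; rewrite opprB addrC subrK.
apply: cL2B => //; split; last by have [] := H 0%N.
by apply: cmfB => //; exact: cL2_meas.
Qed.

Lemma nsqBZ f k c : cL2 P f -> cL2 P k ->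
  nsq P (fun t => f t - c * k t) =
  nsq P f - 2 * Re (c^* * cint P (fun t => f t * (k t)^*)) + sqnormc c * nsq P k.
Proof.
move=> lf lk; have lfk := cL2_mul lf (cL2J lk).
rewrite -cintZ// /= /nsq; have [r1 _] := cL1Z (c^*) lfk.
case: lf lk => _ rf [_ rk].
rewrite -!RintegralZl// -RintegralB//; last exact: rintZ.
rewrite -RintegralD//; [|by apply: rintB => //; exact: rintZ|exact: rintZ].
apply: eq_Rintegral => t _; rewrite /Defs.sqnormc.
by rewrite !(cReM, cImM, cReJ, cImJ, cReD, cImD, cReN, cImN); ring.
Qed.

(* The projection of [u] onto the closure of a linear space [S]; [S] itself need
   not be closed. *)
Lemma cL2_projection (S : set (T -> R[i])) (u : T -> R[i]) : S `<=` cL2 P -> S !=set0 ->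
  (forall f g c, S f -> S g -> S (fun t => f t + c * g t)) -> cL2 P u ->
  exists s h, [/\ forall n, S (s n), cL2 P h,
    nsq P (fun t => s n t - h t) @[n --> \oo] --> 0 &
    forall k, S k -> cint P (fun t => (u t - h t) * (k t)^*) = 0].
Proof.
move=> SL [f0 Sf0] Slin lu.
pose E := [set nsq P (fun t => u t - f t) | f in S].
have lbE : has_lbound E by exists 0 => _ [f _ <-]; exact: nsq_ge0.
have nE : E !=set0 by exists (nsq P (fun t => u t - f0 t)), f0.
pose dd := inf E.
have ddle f : S f -> dd <= nsq P (fun t => u t - f t).
  by move=> Sf; apply: ge_inf => //; exists f.
(* The exponent [n.+1] absorbs the factor 4 produced by the parallelogram law, so that the sequence
   has exactly the rate asked by [cL2_complete]. *)
have /choice[s sP] n : exists f, S f /\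
    nsq P (fun t => u t - f t) < dd + (4^-1) ^+ n.+1.
  have e0 : 0 < (4^-1 : R) ^+ n.+1 by rewrite exprn_gt0// invr_gt0.
  have [_ [f Sf <-] lt] := inf_adherent e0 (conj nE lbE).
  by exists f.
have ls n : cL2 P (s n) by apply: SL; have [] := sP n.
have lus n : cL2 P (fun t => u t - s n t) by exact: cL2B.
have cs n m : (n <= m)%N -> nsq P (fun t => s n t - s m t) <= (4^-1) ^+ n.
  move=> nm.
  have -> : (fun t => s n t - s m t) = (fun t => (u t - s m t) - (u t - s n t)).
    by apply/funext => t; ring.
  rewrite parallelogram//.
  pose g t := s n t + 2^-1 * (s m t - s n t).
  have Sg : S g.
    rewrite (_ : g = fun t => (s n t + (- 2^-1) * s n t) + 2^-1 * s m t).
      have [Sn _] := sP n; have [Sm _] := sP m.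
      exact: (Slin _ _ _ (Slin _ _ _ Sn Sn) Sm).
    by apply/funext => t; rewrite /g mulrBr mulNr; ring.
  have -> : nsq P (fun t => u t - s m t + (u t - s n t)) =
      4 * nsq P (fun t => u t - g t).
    have -> : (4 : R) = sqnormc (2 : R[i]) by rewrite /Defs.sqnormc /=; ring.
    rewrite -nsqZ; last by apply: cL2B => //; exact: SL.
    by congr nsq; apply/funext => t; rewrite /g; field.
  have := ddle _ Sg; have [_] := sP n; have [_] := sP m.
  have : (4^-1 : R) ^+ m.+1 <= (4^-1 : R) ^+ n.+1.
    by rewrite ler_wiXn2l ?invr_ge0// invf_le1// ler1n.
  rewrite !exprS; set X := _ ^+ n; set Y := _ ^+ m.
  move: (nsq P _) (nsq P _) (nsq P _) => a b e; lra.
have [h lh hs] := cL2_complete ls cs.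
have sh : nsq P (fun t => s n t - h t) @[n --> \oo] --> 0.
  apply: (@squeeze_cvgr _ _ _ _ (fun=> 0) (fun n => (4^-1) ^+ n)).
  - by apply: nearW => n; rewrite nsq_ge0 hs.
  - exact: cvg_cst.
  - exact: cvg_quarter_pow.
exists s, h; split => //; first by move=> n; have [] := sP n.
(* First variation in the direction [k]. Since [h] need not lie in [S], the competitor is
   [s n + tau w k], and minimality holds up to [4^-n]; in the limit [tau |w|^2 <= 0]. The choice
   [tau = (N + 1)^-1] makes the quadratic term at most [tau |w|^2], half of the linear gain. *)
move=> k Sk; set w := cint P _; apply/eqP; rewrite -normc_eq0.
apply/negP => /negP w0; have lk := SL _ Sk.
have W0 : 0 < normc w by rewrite lt_neqAle eq_sym w0 normc_ge0.
pose N := nsq P k; pose tau : R := (N + 1)^-1.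
have N0 : 0 <= N by exact: nsq_ge0.
have tau0 : 0 < tau by rewrite invr_gt0 ltr_wpDl.
have tauN : tau * N <= 1 by rewrite mulrC ler_pdivrMr ?ltr_wpDl// mul1r lerDl.
have ew : normc (cint P (fun t => (u t - s n t) * (k t)^*) - w) @[n --> \oo] --> 0.
  apply: (cvg_cint_mul (F := fun n t => u t - s n t)) => //.
  - exact: cL2B.
  - exact: cL2J.
  - rewrite (_ : (fun n => _) = (fun n => nsq P (fun t => s n t - h t))) //.
    apply/funext => n; rewrite nsq_distC; congr nsq.
    by apply/funext => t; ring.
have key n : tau * normc w ^+ 2 <= (4^-1) ^+ n +
    2 * tau * normc w * normc (cint P (fun t => (u t - s n t) * (k t)^*) - w).
  set wn := cint P _; pose c : R[i] := tau%:C%C * w.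
  have Sg : S (fun t => s n t + c * k t) by apply: (Slin) => //; have [] := sP n.
  have := ddle _ Sg.
  rewrite (_ : (fun t => _) = (fun t => (u t - s n t) - c * k t)); last first.
    by apply/funext => t; ring.
  rewrite nsqBZ// -/wn -/N => h1; have [_ h2] := sP n.
  have h3 : Re (c^* * wn) >= tau * (normc w ^+ 2 - normc w * normc (wn - w)).
    have -> : Re (c^* * wn) = tau * (normc w ^+ 2 + Re (w^* * (wn - w))).
      rewrite sqr_normcE /Defs.sqnormc /c.
      rewrite !(cReM, cImM, cReJ, cImJ, cReD, cImD, cReN, cImN) /=; ring.
    rewrite ler_pM2l// lerD2l lerNl (le_trans (ler_norm _))// normrN.
    by rewrite (le_trans (normr_Re_le _))// Normc.normcM normcJE.
  have h4 : sqnormc c * N <= tau * normc w ^+ 2.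
    rewrite /c sqnormcM -[sqnormc w]sqr_normcE -[sqnormc _]sqr_normcE normc_real.
    rewrite (ger0_norm (ltW tau0)) mulrAC ler_wpM2r ?sqr_ge0//.
    by rewrite expr2 -mulrA ger_pMr.
  have h5 : (4^-1 : R) ^+ n.+1 <= (4^-1 : R) ^+ n.
    by rewrite ler_wiXn2l ?invr_ge0// invf_le1// ler1n.
  move: h1 h2 h3 h4 h5.
  move: (nsq P _) (Re _) (normc (wn - w)) (sqnormc c * N) (_ ^+ n) (_ ^+ n.+1).
  move: (normc w) => W a b e f x y; nra.
have X0 : 0 < tau * normc w ^+ 2 by rewrite mulr_gt0// exprn_gt0.
have c0 : (fun n => (4^-1) ^+ n + 2 * tau * normc w *
    normc (cint P (fun t => (u t - s n t) * (k t)^*) - w)) @ \oo --> (0 : R).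
  rewrite -[X in _ --> X](addr0 (0 : R)); apply: cvgD.
    exact: cvg_quarter_pow.
  rewrite -[X in _ --> X](mulr0 (2 * tau * normc w)).
  by apply: cvgM => //; exact: cvg_cst.
have : tau * normc w ^+ 2 <= lim ((fun n => (4^-1) ^+ n + 2 * tau * normc w *
    normc (cint P (fun t => (u t - s n t) * (k t)^*) - w)) @ \oo).
  by apply: limr_ge; [exact: cvgP c0|exact: nearW].
rewrite (cvg_lim _ c0)//.
by rewrite leNgt X0.
Qed.

End completeness.

Lemma ae_imply {d} {T : measurableType d} {R : realType} (P : probability T R)
    (A B : T -> Prop) : (forall t, A t -> B t) ->
  {ae P, forall t, A t} -> {ae P, forall t, B t}.
Proof. by move=> AB; apply: filterS. Qed.

Lemma ae_imply2 {d} {T : measurableType d} {R : realType} (P : probability T R)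
    (A B C : T -> Prop) : (forall t, A t -> B t -> C t) ->
  {ae P, forall t, A t} -> {ae P, forall t, B t} -> {ae P, forall t, C t}.
Proof. by move=> ABC; apply: filterS2. Qed.

(** * The circle: the classes of the statement, and integrals of powers of [expi] *)

Section circle.
Context {R : realType}.
Local Notation mu := (circle_prob R).
Implicit Types (f g h : R -> R[i]) (t : R) (n : nat).

Lemma Lfun2P (u : R -> R) : u \in Lfun mu 2%:E <->
  measurable_fun setT u /\ rint mu (fun t => u t ^+ 2).
Proof.
split=> [lu|[mu_ /integrableP[_ iu]]].
  split; last exact: Lfun2_integrable_sqr lu.
  by move: lu; rewrite inE => /andP[]; rewrite inE.
rewrite inE; apply/andP; split; first by rewrite inE.
rewrite inE /= /finite_norm unlock /Lnorm; apply: poweR_lty.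
move: iu; congr (_ < _)%E; apply: eq_integral => t _ /=.
by rewrite powR_mulrn// real_normK ?num_real// ger0_norm ?sqr_ge0.
Qed.

Lemma L2P f : L2 f <-> cL2 mu f.
Proof.
rewrite /L2 /cLfun /= !Lfun2P; split=> [[[m1 i1] [m2 i2]]|[[m1 m2] i]].
  by split => //; exact: rintD.
split; split => //.
  apply: (@rint_le _ _ _ mu _ (sqnormc \o f)) i => [|t].
    exact: measurable_funX.
  by rewrite /= ger0_norm ?sqr_ge0// lerDl sqr_ge0.
apply: (@rint_le _ _ _ mu _ (sqnormc \o f)) i => [|t].
  exact: measurable_funX.
by rewrite /= ger0_norm ?sqr_ge0// lerDr sqr_ge0.
Qed.

Lemma Lfuny_bounded (u : R -> R) : u \in Lfun mu +oo%E ->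
  measurable_fun setT u /\ exists M : R, {ae mu, forall t, `|u t| <= M}.
Proof.
rewrite inE => /andP[]; rewrite inE => mu_; rewrite inE /= /finite_norm unlock /Lnorm.
have -> : (0 < mu setT)%E.
  by rewrite [X in (0 < X)%E](_ : _ = 1%E) ?lte01//; exact: probability_setT.
move=> hM; split => //.
have : {ae mu, forall t, (`|(u t)%:E| <= ess_sup mu (abse \o (EFin \o u)))%E}.
  exact: ess_sup_ge.
move: hM; case: (ess_sup _ _) => [M _ H|//|_ H].
  exists M; apply: (ae_imply _ H) => t.
  by rewrite lee_fin.
(* An essential supremum equal to [-oo] contradicts the inequality at each point where it holds, so
   any bound serves. *)
by exists 0; apply: (ae_imply _ H) => t.
Qed.

Lemma Linfty_bounded f : Linfty f ->
  cmf f /\ exists M : R, {ae mu, forall t, normc (f t) <= M}.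
Proof.
move=> [/Lfuny_bounded[m1 [M1 b1]] /Lfuny_bounded[m2 [M2 b2]]]; split => //.
exists (M1 + M2); apply: (ae_imply2 _ b1 b2) => t h1 h2.
by rewrite (le_trans (normc_le_ReIm _))// lerD.
Qed.

Lemma expiD (s t : R) : expi (s + t) = expi s * expi t.
Proof.
by apply: complex_ext; rewrite ?cReM ?cImM /= ?cosD ?sinD// addrC.
Qed.

Lemma expiX t n : expi t ^+ n = expi (n%:R * t).
Proof.
elim: n => [|n IH]; first by rewrite expr0 mul0r /expi cos0 sin0.
by rewrite exprS IH -expiD mulrSr mulrDl mul1r addrC.
Qed.

Lemma normc_expi t : normc (expi t) = 1.
Proof. by rewrite /= cos2Dsin2 sqrtr1. Qed.

Lemma normc_expiX t n : normc (expi t ^+ n) = 1.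
Proof. by rewrite normcX normc_expi expr1n. Qed.

Lemma expi_mulJ t : expi t * (expi t)^* = 1.
Proof. by rewrite mulcJE -sqr_normcE normc_expi expr1n. Qed.

Lemma cmf_expi : @cmf _ (measurableTypeR R) _ (@expi R).
Proof.
split; apply: continuous_measurable_fun.
  exact: continuous_cos.
exact: continuous_sin.
Qed.

Lemma cmf_expiX n : @cmf _ (measurableTypeR R) _ (fun t => expi t ^+ n).
Proof. by apply: cmfX; exact: cmf_expi. Qed.

Lemma integral_circle_FTC (f F : R -> R) : continuous f -> (forall t, 0 <= f t) ->
  (forall t : R, is_derive t 1 F (f t)) ->
  (\int[mu]_t (f t)%:E = ((2 * pi)^-1 * (F (2 * pi) - F 0))%:E)%E.
Proof.
move=> cf f0 dF; rewrite integral_uniform//; last first.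
  by apply/measurable_EFinP; exact: continuous_measurable_fun.
rewrite subr0 EFinM; congr (_ * _)%E; apply: continuous_FTC2.
- exact: two_pi_gt0.
- exact: continuous_subspaceT.
- have dvF t : derivable F t 1 by have [] := dF t.
  have cF : continuous F.
    by move=> t; apply: differentiable_continuous; apply/derivable1_diffP.
  split=> [t _||].
  + exact: dvF.
  + by apply: cvg_at_right_filter; exact: cF.
  + by apply: cvg_at_left_filter; exact: cF.
- by move=> t _; rewrite derive1E; exact: derive_val.
Qed.

Lemma cint_expiX n : (0 < n)%N -> cint mu (fun t => expi t ^+ n) = 0.
Proof.
move=> n0; have nR : (n%:R : R) != 0 by rewrite pnatr_eq0 -lt0n.
have p0 := two_pi_gt0 R.
have e1 : expi (n%:R * (2 * pi)) = 1 :> R[i].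
  rewrite -expiX (_ : expi (2 * pi) = 1) ?expr1n//.
  by rewrite /expi mulr_natl cos2pi sin2pi.
have rc : rint mu (fun t => Re (expi t ^+ n)) /\ rint mu (fun t => Im (expi t ^+ n)).
  apply: (@cL1_le _ _ _ mu (fun t => expi t ^+ n) (fun=> 1)).
  - exact: cmf_expiX.
  - by move=> t; rewrite normc_expiX.
  - exact: rint_cst.
have dn (t : R) : is_derive t (1 : R) (fun t => n%:R * t) n%:R.
  have := is_deriveZ (n%:R : R) (is_derive_id t (1 : R)).
  by rewrite [_ *: _](mulr1 _).
have cn : continuous (fun t : R => n%:R * t).
  by move=> t; apply: cvgM => //; exact: cvg_cst.
(* Adding 1 makes the integrand nonnegative, as [integral_circle_FTC] requires; its integral 1 is
   subtracted in [H]. *)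
have Hc : (\int[mu]_t (1 + cos (n%:R * t))%:E = 1)%E.
  apply: etrans (@integral_circle_FTC (fun t => 1 + cos (n%:R * t))
      (fun t => t + n%:R^-1 * sin (n%:R * t)) _ _ _) _.
  - move=> t; apply: cvgD; first exact: cvg_cst.
    by apply: (@cvg_comp _ _ _ (fun t => n%:R * t)); [exact: cn|exact: continuous_cos].
  - by move=> t; rewrite -lerBlDl sub0r cos_geN1.
  - move=> t; have dc := is_derive1_comp (is_derive_sin (n%:R * t)) (dn t).
    have := is_deriveD (is_derive_id t (1 : R)) (is_deriveZ n%:R^-1 dc).
    by rewrite [_ *: _](mulrC) -mulrA mulfV// mulr1.
  - by case: e1 => _ ->; rewrite !mulr0 sin0 !mulr0 !addr0 subr0 mulVf// gt_eqF.
have Hs : (\int[mu]_t (1 + sin (n%:R * t))%:E = 1)%E.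
  apply: etrans (@integral_circle_FTC (fun t => 1 + sin (n%:R * t))
      (fun t => t + n%:R^-1 * - cos (n%:R * t)) _ _ _) _.
  - move=> t; apply: cvgD; first exact: cvg_cst.
    by apply: (@cvg_comp _ _ _ (fun t => n%:R * t)); [exact: cn|exact: continuous_sin].
  - by move=> t; rewrite -lerBlDl sub0r sin_geN1.
  - move=> t; have dc := is_derive1_comp (is_derive_cos (n%:R * t)) (dn t).
    have := is_deriveD (is_derive_id t (1 : R)) (is_deriveZ n%:R^-1 (is_deriveN dc)).
    by rewrite mulNr opprK [_ *: _](mulrC) -mulrA mulfV// mulr1.
  - by case: e1 => -> _; rewrite !mulr0 cos0 add0r addrK mulVf// gt_eqF.
have H (u : R -> R) : rint mu u -> (\int[mu]_t (1 + u t)%:E = 1)%E ->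
    \int[mu]_t u t = 0.
  move=> ru; have r1 : rint mu (fun t => 1 + u t).
    by apply: rintD => //; exact: rint_cst.
  rewrite rint_EFin// RintegralD//; last exact: rint_cst.
  by rewrite rintegral_cst => -[]; lra.
case: rc => rc rs; apply: complex_ext => /=; apply: H => //.
- by rewrite -[RHS]Hc; apply: eq_integral => t _; rewrite expiX.
- by rewrite -[RHS]Hs; apply: eq_integral => t _; rewrite expiX.
Qed.

End circle.

(** * Nontangential limits of Poisson integrals *)

Section approximate_identity.
Context {d} {T : measurableType d} {R : realType} (P : probability T R).
Implicit Types (u v : T -> R).

Lemma measurable_ltr_indic (rho : T -> R) (r : R) : measurable_fun setT rho ->
  measurable_fun setT (fun t => (rho t < r)%R%:R : R).
Proof.
move=> mrho; rewrite (_ : (fun t => _) = fun t => if rho t < r then 1 else 0).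
  by apply: measurable_fun_if => //; apply: measurable_fun_ltr.
by apply/funext => t; case: ifP.
Qed.

Lemma rint_indic (rho : T -> R) (r : R) v : measurable_fun setT rho -> rint P v ->
  rint P (fun t => (rho t < r)%R%:R * v t).
Proof.
move=> mrho rv; apply: (@rint_le _ _ _ P _ (fun t => `|v t|)).
- by apply: measurable_funM; [exact: measurable_ltr_indic|exact: rint_meas rv].
- by move=> t; case: (_ < _)%R; rewrite /= ?mul1r ?mul0r ?normr0.
- exact: rint_norm.
Qed.

(* [W] stands for a Poisson-like kernel times [V]: its size is [V / dl] near the
   centre and [dl / rho ^+ 2 * V] away from it. The integral of [W] over the ball
   of radius [h] is compared with the one over the ball of radius [h / 2]. *)
Lemma kernel_ball_le (V W rho : T -> R) (K dl e eta : R) :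
  rint P V -> rint P W -> measurable_fun setT rho ->
  (forall t, 0 <= V t) -> (forall t, 0 <= W t) ->
  0 < K -> 0 < dl -> 0 < e ->
  (forall t, dl * W t <= K * V t) ->
  (forall t, 0 <= rho t) ->
  (forall t, rho t ^+ 2 * W t <= K * dl * V t) ->
  (forall h, 0 < h -> h <= eta -> \int[P]_t ((rho t < h)%R%:R * V t) <= e * h) ->
  forall n h, dl < 2 * h -> h <= eta -> h <= 2 ^+ n * dl ->
  \int[P]_t ((rho t < h)%R%:R * W t) <= K * e * (9 - 4 * dl / h).
Proof.
move=> rV rW mrho V0 W0 K0 dl0 e0 W1 rho0 W2 VA.
have Kdl : 0 < K / dl by rewrite divr_gt0.
(* Induction on the number of halvings. The shell between [h / 2] and [h] costs [4 dl / h], and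
   [9 - 8 dl / h + 4 dl / h] is again [9 - 4 dl / h]. In the base case [h <= dl < 2 h], so
   [h / dl <= 1] and [4 dl / h <= 8], whence [9 = 1 + 8]. *)
elim=> [|n IH] h dlh hle hn.
  have h0 : 0 < h by lra.
  apply: (@le_trans _ _ (\int[P]_t (K / dl * ((rho t < h)%R%:R * V t)))).
    apply: rintegral_le => [||t]; [exact: rint_indic|by apply: rintZ; exact: rint_indic|].
    case: ltP => _; rewrite /= ?mul1r ?mul0r ?mulr0//.
    by rewrite mulrAC ler_pdivlMr// mulrC.
  rewrite RintegralZl//; last exact: rint_indic.
  rewrite (le_trans (ler_wpM2l (ltW Kdl) (VA _ h0 hle)))//.
  rewrite expr0 mul1r in hn.
  have -> : K / dl * (e * h) = K * e * (h / dl) by ring.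
  rewrite ler_pM2l ?mulr_gt0//.
  have h1 : h / dl <= 1 by rewrite ler_pdivrMr// mul1r.
  have h2 : dl / h <= 2 by rewrite ler_pdivrMr// mulrC mulrC ltW.
  by lra.
have [hdl|hdl] := leP h dl.
  apply: IH => //; have : 1 <= 2 ^+ n :> R by rewrite exprn_ege1// ler1n.
  by move: (2 ^+ n) hdl dl0 => p; nra.
have h0 : 0 < h by lra.
have IHh : \int[P]_t ((rho t < h / 2)%R%:R * W t) <= K * e * (9 - 4 * dl / (h / 2)).
  apply: IH; [lra|lra|].
  by rewrite ler_pdivrMr// mulrAC -exprSr.
have c0 : 0 < 4 * K * dl / h ^+ 2.
  by rewrite divr_gt0 ?exprn_gt0// !mulr_gt0.
apply: (@le_trans _ _ (\int[P]_t ((rho t < h / 2)%R%:R * W t +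
    4 * K * dl / h ^+ 2 * ((rho t < h)%R%:R * V t)))).
  apply: rintegral_le => [||t]; [exact: rint_indic| |].
    by apply: rintD; [exact: rint_indic|apply: rintZ; exact: rint_indic].
  have [h1|h1] := ltP (rho t) (h / 2).
    have -> /= : (rho t < h)%R = true by apply: lt_trans h1 _; lra.
    by rewrite !mul1r lerDl mulr_ge0// ltW.
  case: ltP => _; rewrite /= !(mul0r, mul1r, mulr0, add0r, addr0)//.
  rewrite mulrAC ler_pdivlMr ?exprn_gt0//.
  have h2 : (h / 2) ^+ 2 * W t <= K * dl * V t.
    rewrite (le_trans _ (W2 t))// ler_wpM2r// ler_pXn2r ?nnegrE//; lra.
  have -> : W t * h ^+ 2 = 4 * ((h / 2) ^+ 2 * W t) by field.
  have -> : 4 * K * dl * V t = 4 * (K * dl * V t) by ring.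
  by rewrite ler_pM2l.
rewrite RintegralD//; [|exact: rint_indic|by apply: rintZ; exact: rint_indic].
rewrite RintegralZl//; last exact: rint_indic.
rewrite (le_trans (lerD IHh (ler_wpM2l (ltW c0) (VA _ h0 hle))))//.
have -> : 4 * K * dl / h ^+ 2 * (e * h) = K * e * (4 * dl / h).
  by field; rewrite gt_eqF.
rewrite -mulrDr ler_pM2l ?mulr_gt0//.
have -> : 4 * dl / (h / 2) = 8 * dl / h by field; rewrite gt_eqF.
have : 0 < dl / h by rewrite divr_gt0.
by rewrite -!mulrA; lra.
Qed.

(** Inside radius [eta] the small averages of [V] give the first term, uniformly in [dl]; outside,
    the decay of the kernel gives the second, which tends to 0 with [dl]. *)
Lemma kernel_le (V W rho : T -> R) (K dl e eta : R) :
  rint P V -> rint P W -> measurable_fun setT rho ->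
  (forall t, 0 <= V t) -> (forall t, 0 <= W t) ->
  0 < K -> 0 < dl -> dl <= eta -> 0 < e ->
  (forall t, dl * W t <= K * V t) ->
  (forall t, 0 <= rho t) ->
  (forall t, rho t ^+ 2 * W t <= K * dl * V t) ->
  (forall h, 0 < h -> h <= eta -> \int[P]_t ((rho t < h)%R%:R * V t) <= e * h) ->
  \int[P]_t W t <= 9 * K * e + K * dl / eta ^+ 2 * \int[P]_t V t.
Proof.
move=> rV rW mrho V0 W0 K0 dl0 dleta e0 W1 rho0 W2 VA.
have eta0 : 0 < eta by lra.
have [n hn] : exists n, eta <= 2 ^+ n * dl.
  exists (Num.bound (eta / dl)); rewrite -ler_pdivrMr//.
  rewrite (le_trans (ltW (archi_boundP (divr_ge0 (ltW eta0) (ltW dl0)))))//.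
  by rewrite -natrX ler_nat ltnW// ltn_expl.
have c0 : 0 < K * dl / eta ^+ 2 by rewrite divr_gt0 ?exprn_gt0// mulr_gt0.
apply: (@le_trans _ _ (\int[P]_t ((rho t < eta)%R%:R * W t + K * dl / eta ^+ 2 * V t))).
  apply: rintegral_le => [//||t].
    by apply: rintD; [exact: rint_indic|exact: rintZ].
  case: ltP => h; rewrite /= ?mul1r ?mul0r ?add0r.
    by rewrite lerDl mulr_ge0// ltW.
  rewrite mulrAC ler_pdivlMr ?exprn_gt0// mulrC (le_trans _ (W2 t))//.
  by rewrite ler_wpM2r// ler_pXn2r ?nnegrE// ltW.
rewrite RintegralD//; [|exact: rint_indic|exact: rintZ].
rewrite RintegralZl// lerD2r.
have dleta2 : dl < 2 * eta by lra.
rewrite (le_trans (kernel_ball_le rV rW mrho V0 W0 K0 dl0 e0 W1 rho0 W2 VA dleta2 (lexx _) hn))//.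
have h1 : 0 < K * e * (4 * dl / eta) by rewrite !(mulr_gt0, invr_gt0).
have -> : K * e * (9 - 4 * dl / eta) = 9 * K * e - K * e * (4 * dl / eta) by ring.
by rewrite gerBl ltW.
Qed.

End approximate_identity.

(** * Lebesgue points on the circle, and comparison of chord and parameter *)

Section lebesgue_points.
Context {R : realType}.
Local Notation mu := (circle_prob R).
Local Notation leb := (@lebesgue_measure R).

(** Balls are taken in the parameter, not on the circle; the two differ for small radii only at the
    endpoints 0 and [2 pi], a null set. The bound [e * h] replaces a normalized average, as
    constants are absorbed in [e]. *)
Definition circle_lebesgue_pt (u : R -> R) (t0 : R) : Prop :=
  forall e, 0 < e -> exists2 eta, 0 < eta &
    forall h, 0 < h -> h <= eta ->
      \int[mu]_t ((`|t - t0| < h)%R%:R * `|u t - u t0|) <= e * h.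

Lemma circle_ae_lebesgue (A : R -> Prop) :
  {ae leb, forall t, A t} -> {ae mu, forall t, A t}.
Proof.
move=> [N [mN N0 AN]]; exists N; split => //.
have /null_content_dominatesP := dominates_uniform_prob (two_pi_gt0 R).
exact.
Qed.

Lemma circle_ae_itv : {ae mu, forall t, 0 < t < 2 * pi}.
Proof.
pose D : set (measurableTypeR R) := ~` `]0, (2 * pi)[%classic.
pose pdf : R -> R := uniform_pdf 0 (2 * pi).
exists D; split; first exact: measurableC.
- change (\int[leb]_(x in D) (pdf x)%:E = 0)%E.
  rewrite integral_uniform_pdf.
  have c : countable (D `&` `[0, (2 * pi)]%classic : set R).
    apply: (@sub_countable _ _ _ ([set 0; 2 * pi] : set R)).
      apply: subset_card_le => x [/= h /=]; rewrite in_itv/= => /andP[x0 xp].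
      move: x0 xp; rewrite !le_eqVlt => /predU1P[<-|x0]; first by left.
      move=> /predU1P[->|xp]; first by right.
      by exfalso; apply: h; rewrite /= in_itv/= x0 xp.
    by apply: finite_set_countable; exact: finite_set2.
  have mA : measurable (D `&` `[0, (2 * pi)]%classic : set (measurableTypeR R)).
    by apply: measurableI => //; exact: measurableC.
  apply: null_set_integral => //; last exact: countable_lebesgue_measure0.
  by apply/measurable_EFinP; apply: measurable_funTS; exact: measurable_uniform_pdf.
- move=> t /= h; rewrite /D /= in_itv/= => ht; exact: h.
Qed.

Lemma rint_circle_lebesgue (u : R -> R) : rint mu u ->
  leb.-integrable `[0, (2 * pi)]%classic (EFin \o u).
Proof.
move=> ru; have mu_ := rint_meas ru; apply/integrableP; split.
  by apply/measurable_EFinP; exact: measurable_funTS.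
move/integrableP : ru => [_]; rewrite integral_uniform//; last first.
  by apply: measurableT_comp => //; exact/measurable_EFinP.
rewrite subr0 => h; rewrite ltey; apply/eqP => hy; move: h.
by rewrite hy gt0_muley ?ltxx// lte_fin invr_gt0 two_pi_gt0.
Qed.

(** Lebesgue differentiation on the line is applied to [u] cut off outside the parameter interval;
    the density [(2 pi)^-1] of the circle measure is at most 1 and only helps. *)
Lemma ae_circle_lebesgue_pt (u : R -> R) : rint mu u ->
  {ae mu, forall t, circle_lebesgue_pt u t}.
Proof.
move=> ru; have iu := rint_circle_lebesgue ru.
have mI : measurable (`[0, (2 * pi)]%classic : set (measurableTypeR R)) by exact: measurable_itv.
have := lebesgue_differentiation (integrable_locally_restrict mI iu).
move=> /circle_ae_lebesgue H; apply: (ae_imply2 _ H circle_ae_itv) => {H} t0 lt0 t0I.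
pose I : set R := `[0, (2 * pi)]%classic.
pose v : R -> R := u \_ I.
move=> e e0.
move/andP: t0I => [t00 t0p].
(* Half of [e], because a ball of radius [h] has length [2 h]. *)
have /fine_cvgP[fn /cvgrPdist_lt/(_ (e / 2))] := lt0.
move=> /(_ (divr_gt0 e0 (ltr0Sn _ 1))) dn.
have : \forall r \near (0 : R)^'+,
    (davg v t0 r <= (e / 2)%:E)%E.
  near=> r.
  have fr : davg v t0 r \is a fin_num by near: r.
  have dr : `|0 - fine (davg v t0 r)| < e / 2 by near: r.
  rewrite -(fineK fr) lee_fin (le_trans _ (ltW dr))// sub0r normrN.
  exact: ler_norm.
rewrite /at_right near_withinE => /nbhs_ballP[eta /= eta0 He].
exists (eta / 2); first by rewrite divr_gt0.
move=> h h0 he; have {He} : (davg v t0 h <= (e / 2)%:E)%E.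
  by apply: He => //; rewrite /ball/= sub0r normrN gtr0_norm//; lra.
rewrite /davg /iavg (lebesgue_measure_ball _ (ltW h0)).
rewrite inver mulrn_eq0 /= gt_eqF// lee_pdivrMl ?pmulrn_lgt0// => H.
have r1 : rint mu (fun t => `|u t - u t0|).
  by apply: rint_norm; apply: rintB => //; exact: rint_cst.
have mrho : measurable_fun setT (fun t : measurableTypeR R => `|t - t0|).
  by apply: continuous_measurable_fun => t; apply: cvg_norm; apply: cvgB;
    [exact: cvg_id|exact: cvg_cst].
have r2 := rint_indic h mrho r1.
have m2 := rint_meas r2.
rewrite -lee_fin -rint_EFin// integral_uniform; last 2 first.
  exact/measurable_EFinP.
  by move=> t; rewrite lee_fin mulr_ge0.
have m3 : measurable_fun setT (fun t : measurableTypeR R =>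
    `|(v t - v t0)%:E|%E).
  apply/measurable_EFinP; apply: measurableT_comp => //; apply: measurable_funB => //.
  apply/(measurable_restrictT _ _).1 => //; apply: measurable_funTS.
  exact: rint_meas ru.
have le1 : (\int[leb]_(x in I) ((`|x - t0| < h)%R%:R * `|u x - u t0|)%:E
    <= (e * h)%:E)%E.
  apply: (@le_trans _ _ ((h *+ 2)%:E * (e / 2)%:E)%E); last first.
    by rewrite -EFinM lee_fin le_eqVlt; apply/orP; left; apply/eqP; field.
  apply: le_trans H; rewrite [leLHS]integral_mkcond [leRHS]integral_mkcond.
  apply: ge0_le_integral => //.
  - by move=> t _; rewrite patchE; case: ifP => // _; rewrite lee_fin mulr_ge0.
  - apply/(measurable_restrictT _ _).1 => //; apply: measurable_funTS.
    exact/measurable_EFinP.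
  - apply/(measurable_restrictT _ _).1; first exact: measurable_ball.
    exact: measurable_funTS.
  - move=> t _; rewrite !patchE; case: ifPn => tI; last first.
      by case: ifP => // _; rewrite lee_fin.
    have t0I : t0 \in I.
      by rewrite inE /I /= in_itv/= !ltW.
    case: ifPn => tb /=.
      rewrite /v !patchE tI t0I lee_fin; case: (_ < _)%R; rewrite /= ?mul1r ?mul0r//.
    rewrite lee_fin; case: ltP => // lt; rewrite ?mul0r//.
    by exfalso; move/negP: tb; apply; rewrite inE /ball/= distrC.
rewrite (le_trans _ le1)// subr0 -[leRHS]mul1e lee_wpmul2r//.
  by apply: integral_ge0 => t _; rewrite lee_fin mulr_ge0.
rewrite lee_fin invf_le1 ?two_pi_gt0//; have := pi_ge2 R; lra.
Unshelve. all: by end_near. Qed.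

(** On [[0, 1]] the mean value theorem gives slope at least [cos 1]; on [[1, Y]] the sine has a
    positive minimum because [Y < pi]. *)
Lemma sin_lower_bound (Y : R) : 0 < Y -> Y < pi ->
  exists2 c, 0 < c & forall y, 0 <= y -> y <= Y -> c * y <= sin y.
Proof.
move=> Y0 Ypi.
have c1 := cos1_gt0 R.
have small (y : R) : 0 <= y -> y <= 1 -> cos 1 * y <= sin y.
  rewrite le_eqVlt => /predU1P[<-|y0 y1]; first by rewrite mulr0 sin0.
  have [c] := @MVT R sin cos 0 y y0 (fun x _ => is_derive_sin x)
    (continuous_subspaceT (@continuous_sin R)).
  rewrite in_itv/= sin0 !subr0 => /andP[c0 cy] ->; rewrite ler_pM2r//.
  have pi1 : 1 <= pi :> R by rewrite (le_trans _ (pi_ge2 R))// ler1n.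
  by apply: ltW; rewrite ltr_cos ?in_itv/= ?ler01 ?pi1//; [lra|apply/andP; split; lra].
have [Y1|Y1] := leP Y 1.
  by exists (cos 1) => // y y0 yY; apply: small => //; lra.
have [m] := EVT_min (ltW Y1) (continuous_subspaceT (@continuous_sin R)).
rewrite in_itv/= => /andP[m1 mY] hm.
have sm : 0 < sin m by apply: sin_gt0_pi; apply/andP; split; lra.
exists (Num.min (cos 1) (sin m / pi)).
  by rewrite lt_min c1 divr_gt0// pi_gt0.
move=> y y0 yY; have [y1|y1] := leP y 1.
  by rewrite (le_trans _ (small _ y0 y1))// ler_wpM2r// ge_min lexx.
rewrite (@le_trans _ _ (sin m / pi * y))//.
  by rewrite ler_wpM2r// ge_min lexx orbT.
rewrite (@le_trans _ _ (sin m))//; last by apply: hm; rewrite in_itv/= ltW.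
by rewrite mulrAC -mulrA ger_pMr// ler_pdivrMr ?pi_gt0// mul1r; lra.
Qed.

Lemma sqnormc_expiB (s t : R) :
  sqnormc (expi t - expi s) = 4 * sin ((t - s) / 2) ^+ 2.
Proof.
rewrite /Defs.sqnormc cReD cImD cReN cImN /=.
have -> : sin ((t - s) / 2) ^+ 2 = (1 - cos (t - s)) / 2.
  have {2}-> : t - s = ((t - s) / 2) *+ 2 by rewrite mulr2n; field.
  by rewrite cos_mulr2n cos2sin2; field.
rewrite cosB; have := cos2Dsin2 s; have := cos2Dsin2 t; lra.
Qed.

Lemma expiB_lower_bound (t0 : R) : 0 < t0 -> t0 < 2 * pi ->
  exists2 k, 0 < k & forall t, 0 <= t -> t <= 2 * pi ->
    k * (t - t0) ^+ 2 <= sqnormc (expi t - expi t0).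
Proof.
(* [Y] is the largest value of [|t - t0| / 2] on the parameter interval; it stays below [pi] because
   [t0] is interior. *)
move=> t00 t0p; pose Y := Num.max (t0 / 2) (pi - t0 / 2).
have Y0 : 0 < Y by rewrite lt_max; apply/orP; left; lra.
have Yp : Y < pi by rewrite gt_max; apply/andP; split; lra.
have [c c0 cY] := sin_lower_bound Y0 Yp.
exists (c ^+ 2); first by rewrite exprn_gt0.
move=> t tge tle; rewrite sqnormc_expiB.
have -> : sin ((t - t0) / 2) ^+ 2 = sin (`|t - t0| / 2) ^+ 2.
  by case: (ler0P (t - t0)) => _ //; rewrite mulNr sinN sqrrN.
have yY : `|t - t0| / 2 <= Y.
  rewrite le_max; case: (ler0P (t - t0)) => _; apply/orP; [left|right]; lra.
have y0 : 0 <= `|t - t0| / 2 by rewrite divr_ge0.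
have := cY _ y0 yY => h.
have -> : c ^+ 2 * (t - t0) ^+ 2 = 4 * (c * (`|t - t0| / 2)) ^+ 2.
  by rewrite !exprMn real_normK ?num_real//; field.
by rewrite ler_pM2l// ler_pXn2r ?nnegrE//; [rewrite mulr_ge0// ltW|
  rewrite (le_trans _ h)// mulr_ge0// ltW].
Qed.

End lebesgue_points.

(** * Geometric series under the integral, and the Poisson kernel *)

Section poisson.
Context {R : realType}.
Local Notation mu := (circle_prob R).
Implicit Types (z w : R[i]).

Lemma cmfV d (T : measurableType d) (f : T -> R[i]) : cmf f ->
  cmf (fun t => (f t)^-1).
Proof.
move=> mf; have ms := measurable_sqnormc mf; case: mf => m1 m2.
have mi : measurable_fun setT (fun t => (sqnormc (f t))^-1).
  rewrite (_ : (fun t => _) = (@powR R ^~ (-1)) \o (sqnormc \o f)).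
    by apply: (measurableT_comp (measurable_powR _)).
  by apply/funext => t /=; rewrite powR_inv1// sqnormc_ge0.
split.
- rewrite (_ : _ \o _ = (Re \o f) \* (fun t => (sqnormc (f t))^-1)).
    exact: measurable_funM.
  by apply/funext => t /=; case: (f t).
- rewrite (_ : _ \o _ = (\- (Im \o f)) \* (fun t => (sqnormc (f t))^-1)).
    by apply: measurable_funM => //; exact: measurable_funN.
  by apply/funext => t /=; case: (f t) => a b; rewrite /Defs.sqnormc /= mulNr.
Qed.

Lemma normc_1sub_ge w : 1 - normc w <= normc (1 - w).
Proof.
rewrite lerBlDr; apply: le_trans (ler_normcD _ _).
by rewrite subrK Normc.normc1.
Qed.

Lemma sub1_neq0 w : normc w < 1 -> 1 - w != 0.
Proof.
move=> w1; rewrite -normc_eq0 gt_eqF// (lt_le_trans _ (normc_1sub_ge w))//.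
by rewrite subr_gt0.
Qed.

Lemma normc_inv1B_le w : normc w < 1 -> normc (1 - w)^-1 <= (1 - normc w)^-1.
Proof.
move=> w1; rewrite Normc.normcV lef_pV2 ?posrE ?subr_gt0// ?normc_1sub_ge//.
by rewrite (lt_le_trans _ (normc_1sub_ge w))// subr_gt0.
Qed.

Section geometric_integral.
Variables (f e : R -> R[i]) (w : R[i]).
Hypotheses (lf : cL1 mu f) (me : @cmf _ (measurableTypeR R) _ e).
Hypotheses (e1 : forall t, normc (e t) = 1) (w1 : normc w < 1).

Lemma normc_mul_unit (t : R) : normc (w * e t) = normc w.
Proof. by rewrite Normc.normcM e1 mulr1. Qed.

Lemma cmf_geometric n : @cmf _ (measurableTypeR R) _
  (fun t => (w * e t) ^+ n * (1 - w * e t)^-1).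
Proof.
have mwe : @cmf _ (measurableTypeR R) _ (fun t => w * e t).
  by apply: cmfM => //; exact: cmf_cst.
apply: cmfM; first exact: cmfX.
by apply: cmfV; apply: cmfB => //; exact: cmf_cst.
Qed.

Lemma cL1_geometric n : cL1 mu (fun t => f t * ((w * e t) ^+ n * (1 - w * e t)^-1)).
Proof.
apply: (cL1_bounded (M := (1 - normc w)^-1)) => //; first exact: cmf_geometric.
move=> t; rewrite Normc.normcM normcX -[leRHS]mul1r ler_pM ?normc_ge0//.
- by rewrite exprn_ge0// normc_ge0.
- by rewrite normc_mul_unit exprn_ile1 ?normc_ge0// ltW.
- by rewrite (le_trans (normc_inv1B_le _)) ?normc_mul_unit.
Qed.

Lemma cL1_unitX n : cL1 mu (fun t => f t * e t ^+ n).
Proof.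
apply: (cL1_bounded (M := 1)) => //; first exact: cmfX.
by move=> t; rewrite normcX e1 expr1n.
Qed.

(** The finite geometric sum with its remainder, which is uniformly small since [|w e| = |w| < 1],
    so only finite sums are exchanged with the integral. Here [e] stands for [expi] or its
    conjugate, one for each direction of Fourier indices. *)
Lemma cint_geometric n : cint mu (fun t => f t * (1 - w * e t)^-1) =
  \sum_(0 <= k < n) w ^+ k * cint mu (fun t => f t * e t ^+ k) +
  cint mu (fun t => f t * ((w * e t) ^+ n * (1 - w * e t)^-1)).
Proof.
elim: n => [|n IH].
  by rewrite big_nil add0r; congr cint; apply/funext => t; rewrite expr0 mul1r.
rewrite IH big_nat_recr//= -addrA; congr (_ + _).
rewrite -cintZ; last exact: cL1_unitX.
rewrite -cintD; [|by apply: cL1Z; exact: cL1_unitX|exact: cL1_geometric].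
congr cint; apply/funext => t.
have h : 1 - w * e t != 0 by rewrite sub1_neq0// normc_mul_unit.
by rewrite exprS exprMn; field.
Qed.

Lemma cvg_cint_geometric :
  normc (series (fun n => w ^+ n * cint mu (fun t => f t * e t ^+ n)) n -
    cint mu (fun t => f t * (1 - w * e t)^-1)) @[n --> \oo] --> 0.
Proof.
pose C := \int[mu]_t normc (f t) * (1 - normc w)^-1.
apply: (@squeeze_cvgr _ _ _ _ (fun=> 0) (fun n => C * normc w ^+ n)).
- apply: nearW => n; rewrite normc_ge0/= (cint_geometric n) /series/=.
  rewrite opprD addNKr normcNE (le_trans (normc_cint_le (cL1_geometric n)))//.
  rewrite /C mulrAC -mulrA -RintegralZr//; last exact: cL1_normc.
  apply: rintegral_le => [||t].
  - exact/cL1_normc/cL1_geometric.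
  - rewrite (_ : (fun t => _) = (fun t => (normc w ^+ n * (1 - normc w)^-1) * normc (f t))).
      by apply: rintZ; exact: cL1_normc.
    by apply/funext => t; rewrite mulrC.
  - rewrite !Normc.normcM ler_wpM2l ?normc_ge0// normcX normc_mul_unit.
    rewrite ler_wpM2l ?exprn_ge0 ?normc_ge0//.
    by rewrite (le_trans (normc_inv1B_le _)) ?normc_mul_unit.
- exact: cvg_cst.
- rewrite -[X in _ --> X](mulr0 C); apply: cvgM; first exact: cvg_cst.
  have := @cvg_geometric R 1 (normc w).
  rewrite ger0_norm ?normc_ge0// => /(_ w1).
  rewrite (_ : geometric 1 (normc w) = fun n => normc w ^+ n)//.
  by apply/funext => n; rewrite /= mul1r.
Qed.

End geometric_integral.

Definition poisson_kernel z (t : R) : R := (1 - sqnormc z) / sqnormc (expi t - z).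

Lemma expi_neq0 (t : R) : expi t != 0 :> R[i].
Proof. by rewrite -normc_eq0 normc_expi oner_neq0. Qed.

Lemma normc_expiB_ge z (t : R) : 1 - normc z <= normc (expi t - z).
Proof.
rewrite lerBlDr; apply: le_trans (ler_normcD _ _).
by rewrite subrK normc_expi.
Qed.

Lemma sqnormc_expiB_gt0 z (t : R) : normc z < 1 -> 0 < sqnormc (expi t - z).
Proof.
move=> z1; rewrite -sqr_normcE exprn_gt0// (lt_le_trans _ (normc_expiB_ge z t))//.
by rewrite subr_gt0.
Qed.

Lemma poisson_kernel_ge0 z (t : R) : normc z < 1 -> 0 <= poisson_kernel z t.
Proof.
move=> z1; rewrite divr_ge0 ?sqnormc_ge0// subr_ge0 -sqr_normcE.
by rewrite exprn_ile1 ?normc_ge0// ltW.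
Qed.

Lemma one_sub_sqnormc_le z : normc z < 1 -> 1 - sqnormc z <= 2 * (1 - normc z).
Proof.
by rewrite -sqr_normcE; have := normc_ge0 z; move: (normc z) => x; nra.
Qed.

Lemma poisson_kernel_le z (t : R) : normc z < 1 ->
  (1 - normc z) * poisson_kernel z t <= 2.
Proof.
move=> z1; rewrite /poisson_kernel mulrA ler_pdivrMr ?sqnormc_expiB_gt0//.
have := one_sub_sqnormc_le z1; have := normc_expiB_ge z t.
rewrite -[sqnormc (_ - _)]sqr_normcE.
move: (normc z) z1 (normc (_ - _)) (sqnormc z) => x x1 y s h1 h2.
have : (1 - x) * (1 - s) <= (1 - x) * (2 * (1 - x)) by rewrite ler_wpM2l//; lra.
nra.
Qed.

Lemma measurable_poisson_kernel z :
  measurable_fun [set: measurableTypeR R] (poisson_kernel z).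
Proof.
have mf : @cmf _ (measurableTypeR R) _ (fun t => (expi t - z)^-1).
  by apply: cmfV; apply: cmfB; [exact: cmf_expi|exact: cmf_cst].
rewrite (_ : poisson_kernel z =
    (fun t => (1 - sqnormc z) * sqnormc ((expi t - z)^-1))).
  by apply: measurable_funM => //; exact: measurable_sqnormc.
apply/funext => t; rewrite /poisson_kernel; congr (_ * _).
by rewrite -!sqr_normcE Normc.normcV exprVn.
Qed.

Lemma rint_poisson z (u : R -> R) : normc z < 1 -> rint mu u ->
  rint mu (fun t => poisson_kernel z t * u t).
Proof.
move=> z1 ru; have z0 : 0 < 1 - normc z by rewrite subr_gt0.
apply: (@rint_le _ _ _ mu _ (fun t => 2 / (1 - normc z) * `|u t|)).
- apply: measurable_funM; first exact: measurable_poisson_kernel.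
  exact: rint_meas ru.
- move=> t; rewrite normrM ger0_norm ?poisson_kernel_ge0// ler_wpM2r//.
  by rewrite ler_pdivlMr// mulrC poisson_kernel_le.
- by apply: rintZ; exact: rint_norm.
Qed.

(** Splits the kernel into a series in powers of [z] and one in positive powers of [z^*]. The latter
    meets only the coefficients [ncoef f n] with [n > 0], so it disappears for functions of
    [H^2]. *)
Lemma poisson_kernelE z (t : R) : normc z < 1 ->
  (poisson_kernel z t)%:C%C =
  (1 - z * (expi t)^*)^-1 + z^* * expi t * (1 - z^* * expi t)^-1.
Proof.
move=> z1.
have n1 : 1 - z * (expi t)^* != 0.
  by rewrite sub1_neq0// Normc.normcM normcJE normc_expi mulr1.
have n2 : 1 - z^* * expi t != 0.
  by rewrite sub1_neq0// Normc.normcM normcJE normc_expi mulr1.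
have ee := expi_mulJ t.
have E : (sqnormc (expi t - z))%:C%C = (1 - z * (expi t)^*) * (1 - z^* * expi t).
  rewrite -mulcJE rmorphB/=.
  transitivity (expi t * (expi t)^* * (1 - z * (expi t)^*) * (1 - z^* * expi t)); last first.
    by rewrite ee mul1r.
  have -> : (expi t - z) = expi t * (1 - z * (expi t)^*).
    by rewrite mulrBr mulr1 mulrCA ee mulr1.
  have -> : (expi t)^* - z^* = (expi t)^* * (1 - z^* * expi t).
    by rewrite mulrBr mulr1 mulrCA [(expi t)^* * _]mulrC ee mulr1.
  by ring.
rewrite /poisson_kernel rmorphM/= fmorphV/= E rmorphB/= rmorph1 -mulcJE.
rewrite -[1 - z * z^*](_ : (1 - z^* * expi t) + z^* * expi t * (1 - z * (expi t)^*) = _).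
  by field; rewrite n1 n2.
rewrite mulrBr mulr1 addrA subrK; congr (_ - _).
by rewrite mulrACA [z^* * z]mulrC ee mulr1.
Qed.

Definition poisson (f : R -> R[i]) z : R[i] := cint mu (fun t => (poisson_kernel z t)%:C%C * f t).

End poisson.

(** * Poisson integrals as power series, and Fatou's theorem at Lebesgue points *)

Section fatou.
Context {R : realType}.
Local Notation mu := (circle_prob R).
Implicit Types (z w : R[i]) (f : R -> R[i]).

Lemma cvg_dist_unique (a : nat -> R[i]) x y :
  normc (a n - x) @[n --> \oo] --> (0 : R) ->
  (\forall n \near \oo, a n = y) -> x = y.
Proof.
move=> ax ay; apply/eqP; rewrite eq_sym -subr_eq0 -normc_eq0 eq_le normc_ge0 andbT.
by apply: (cvgr_to_ge ax); apply: filterS ay => n ->.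
Qed.

Lemma cmf_expiJ : @cmf _ (measurableTypeR R) _ (fun t => (expi t)^*).
Proof. by apply: cmfJ; exact: cmf_expi. Qed.

Lemma normc_expiJ (t : R) : normc ((expi t)^*) = 1.
Proof. by rewrite normcJE normc_expi. Qed.

(* Fourier coefficients of index [n] and [- n]. *)
Definition fcoef f n : R[i] := cint mu (fun t => f t * (expi t)^* ^+ n).
Definition ncoef f n : R[i] := cint mu (fun t => f t * expi t ^+ n).

Lemma cint_geometric_coef0 f e w : cL1 mu f ->
  @cmf _ (measurableTypeR R) _ e -> (forall t, normc (e t) = 1) -> normc w < 1 ->
  (forall n, (0 < n)%N -> cint mu (fun t => f t * e t ^+ n) = 0) ->
  cint mu (fun t => f t * (1 - w * e t)^-1) = cint mu f.
Proof.
move=> lf me e1 w1 f0; apply: (cvg_dist_unique (cvg_cint_geometric lf me e1 w1)).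
exists 1%N => // n /= n1; rewrite /series/= -(prednK n1) big_nat_recl// big1_seq.
  by rewrite addr0 expr0 mul1r; congr cint; apply/funext => t; rewrite mulr1.
by move=> k _; rewrite f0// mulr0.
Qed.

Lemma poisson_split f z : cL1 mu f -> normc z < 1 ->
  (forall n, (0 < n)%N -> ncoef f n = 0) ->
  poisson f z = cint mu (fun t => f t * (1 - z * (expi t)^*)^-1).
Proof.
move=> lf z1 f0; have z1' : normc (z^*) < 1 by rewrite normcJE.
have l1 := cL1_geometric lf cmf_expiJ normc_expiJ z1 0.
have l2 := cL1_geometric lf (@cmf_expi R) (@normc_expi R) z1' 1.
(* The full geometric integral equals its term of index 0, so the remainder after one term, which is
   the antianalytic part of the kernel, integrates to 0. *)
have E := cint_geometric lf (@cmf_expi R) (@normc_expi R) z1' 1.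
rewrite big_nat1 expr0 mul1r (cint_geometric_coef0 lf (@cmf_expi R) (@normc_expi R))// in E.
have {}E : cint mu (fun t => f t * ((z^* * expi t) ^+ 1 * (1 - z^* * expi t)^-1)) = 0.
  apply: (addrI (cint mu f)); rewrite addr0 [RHS]E; congr (cint _ _ + _).
  by apply/funext => t; rewrite expr0 mulr1.
rewrite /poisson (_ : (fun t => _) = (fun t =>
    f t * ((z * (expi t)^*) ^+ 0 * (1 - z * (expi t)^*)^-1) +
    f t * ((z^* * expi t) ^+ 1 * (1 - z^* * expi t)^-1))).
  rewrite cintD// E addr0; congr cint.
  by apply/funext => t; rewrite expr0 mul1r.
by apply/funext => t; rewrite poisson_kernelE// expr0 expr1 mul1r mulrC mulrDr.
Qed.

Lemma cvg_poisson_series f z : cL1 mu f -> normc z < 1 ->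
  (forall n, (0 < n)%N -> ncoef f n = 0) ->
  normc (series (fun n => z ^+ n * fcoef f n) n - poisson f z) @[n --> \oo] --> (0 : R).
Proof.
move=> lf z1 f0; rewrite poisson_split//.
exact: cvg_cint_geometric lf cmf_expiJ normc_expiJ z1.
Qed.

Lemma poisson_eq0 f z : cL1 mu f -> normc z < 1 ->
  (forall n, (0 < n)%N -> ncoef f n = 0) -> (forall n, fcoef f n = 0) ->
  poisson f z = 0.
Proof.
move=> lf z1 f0 f0'; apply: (cvg_dist_unique (cvg_poisson_series lf z1 f0)).
apply: nearW => n; rewrite /series/= big1_seq// => k _.
by rewrite f0' mulr0.
Qed.

Lemma integral_poisson_kernel z : normc z < 1 -> \int[mu]_t poisson_kernel z t = 1.
Proof.
move=> z1; have l1 : cL1 mu (fun=> 1 : R[i]) by exact: cL1_cst.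
have : poisson (fun=> 1) z = 1.
  rewrite poisson_split//; last first.
    move=> n n0; rewrite /ncoef -[RHS](cint_expiX n0); congr cint.
    by apply/funext => t; rewrite mul1r.
  rewrite (cint_geometric_coef0 l1 cmf_expiJ normc_expiJ)// ?cint_cst// => n n0.
  transitivity ((cint mu (fun t => expi t ^+ n))^*); last first.
    by rewrite cint_expiX// rmorph0.
  rewrite -cintJ.
    by congr cint; apply/funext => t; rewrite mul1r rmorphXn.
  apply: (cL1_le (u := fun=> 1)); [exact: cmf_expiX| |exact: rint_cst].
  by move=> t; rewrite normc_expiX.
move=> /(congr1 (@complex.Re R)) /= <-; apply: eq_Rintegral => t _ /=.
by ring.
Qed.

(** [kernel_le] with [V = |u - u t0|] and [dl = 1 - |z|]. In the Stolz region [|expi t - expi t0| <=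
    (1 + alpha) |expi t - z|], so the Poisson kernel decays like [dl / (t - t0)^2]. *)
Lemma real_fatou (u : R -> R) (t0 alpha e : R) : rint mu u -> 0 < t0 < 2 * pi ->
  circle_lebesgue_pt u t0 -> 0 < alpha -> 0 < e -> exists2 d, 0 < d &
  forall z, normc (z - expi t0) < alpha * (1 - normc z) -> 1 - normc z < d ->
    `|\int[mu]_t (poisson_kernel z t * u t) - u t0| <= e.
Proof.
move=> ru /andP[t00 t0p] lt0 al0 e0.
have [k k0 hk] := expiB_lower_bound t00 t0p.
(* The summand 2 serves the bound of the kernel near the centre, the other one its decay. *)
pose K := 2 + 2 * (1 + alpha) ^+ 2 / k.
have K2 : 2 <= K.
  by rewrite lerDl mulr_ge0 ?invr_ge0 ?(ltW k0)// mulr_ge0// sqr_ge0.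
have K0 : 0 < K by lra.
have e'0 : 0 < e / (18 * K) by rewrite divr_gt0// mulr_gt0.
have [eta eta0 heta] := lt0 _ e'0.
pose V (t : R) := `|u t - u t0|.
have rV : rint mu V by apply: rint_norm; apply: rintB => //; exact: rint_cst.
have V0 t : 0 <= V t by exact: normr_ge0.
pose M := \int[mu]_t V t.
have M0 : 0 <= M by exact: Rintegral_ge0.
have d20 : 0 < e * eta ^+ 2 / (2 * K * (M + 1)).
  (* With [e / (18 K)] in place of [e], the first term of [kernel_le] is [e / 2]; this second bound
     on [1 - |z|] makes the other term at most [e / 2]. *)
  by rewrite divr_gt0 ?mulr_gt0 ?exprn_gt0//; lra.
exists (Num.min eta (e * eta ^+ 2 / (2 * K * (M + 1)))); first by rewrite lt_min eta0.
move=> z zs; rewrite lt_min => /andP[zeta zd].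
have dl0 : 0 < 1 - normc z.
  by rewrite -(pmulr_rgt0 _ al0); apply: le_lt_trans zs; exact: normc_ge0.
have z1 : normc z < 1 by lra.
(* The kernel is periodic but [|t - t0|] is not, so its decay holds only on the parameter interval;
   outside it, where the measure has no mass, [W] is set to 0. *)
pose W (t : R) : R := ((0 <= t <= 2 * pi)%R)%:R * (poisson_kernel z t * V t).
have pV0 t : 0 <= poisson_kernel z t * V t by rewrite mulr_ge0// poisson_kernel_ge0.
have rpV : rint mu (fun t => poisson_kernel z t * V t) by exact: rint_poisson.
have WpV t : `|W t| <= poisson_kernel z t * V t.
  by rewrite /W; case: (_ <= _ <= _)%R; rewrite /= ?mul1r ?mul0r ?normr0// ger0_norm.
have mW : measurable_fun [set: measurableTypeR R] W.
  apply: measurable_funM; last exact: rint_meas rpV.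
  rewrite (_ : (fun t => _) = fun t : measurableTypeR R => if 0 <= t <= 2 * pi then 1 else 0).
    apply: measurable_fun_if => //; apply: measurable_and.
      exact: measurable_fun_ler.
    exact: measurable_fun_ler.
  by apply/funext => t; case: (_ <= _ <= _)%R.
have rW : rint mu W by exact: rint_le mW WpV rpV.
have rpu : rint mu (fun t => poisson_kernel z t * u t) by exact: rint_poisson.
have rp1 : rint mu (poisson_kernel z).
  rewrite /rint (_ : _ \o _ = EFin \o (fun t => poisson_kernel z t * 1)).
    by apply: rint_poisson => //; exact: rint_cst.
  by apply/funext => t /=; rewrite mulr1.
have rpc : rint mu (fun t => poisson_kernel z t * u t0).
  by apply: rint_poisson => //; exact: rint_cst.
have -> : \int[mu]_t (poisson_kernel z t * u t) - u t0 =
    \int[mu]_t (poisson_kernel z t * (u t - u t0)).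
  rewrite (_ : (fun t => poisson_kernel z t * (u t - u t0)) =
    (fun t => poisson_kernel z t * u t - poisson_kernel z t * u t0)); last first.
    by apply/funext => t; rewrite mulrBr.
  by rewrite RintegralB// RintegralZr// integral_poisson_kernel// mul1r.
have rpb : rint mu (fun t => poisson_kernel z t * (u t - u t0)).
  by apply: rint_poisson => //; apply: rintB => //; exact: rint_cst.
rewrite (le_trans (le_normr_Rintegral _ rpb))//.
have -> : \int[mu]_t `|poisson_kernel z t * (u t - u t0)| = \int[mu]_t W t.
  apply: rintegral_ae_eq => //; first exact: rint_meas (rint_norm rpb).
  apply: (ae_imply _ (@circle_ae_itv R)) => t /andP[t0' tp].
  by rewrite /W !ltW//= mul1r normrM ger0_norm// poisson_kernel_ge0.
have mrho : measurable_fun setT (fun t : measurableTypeR R => `|t - t0|).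
  by apply: continuous_measurable_fun => t; apply: cvg_norm; apply: cvgB;
    [exact: cvg_id|exact: cvg_cst].
have H := @kernel_le _ _ _ mu V W (fun t => `|t - t0|) K (1 - normc z)
  (e / (18 * K)) eta rV rW mrho V0.
apply: (le_trans (H _ K0 dl0 (ltW zeta) e'0 _ _ _ heta)) => {H}.
- by move=> t; rewrite /W mulr_ge0.
- move=> t; rewrite /W; case: (_ <= _ <= _)%R; rewrite /= ?mul1r ?mul0r ?mulr0; last first.
    by rewrite mulr_ge0// ltW.
  by rewrite mulrA ler_wpM2r// (le_trans (poisson_kernel_le t z1)).
- by move=> t.
- move=> t; rewrite /W; have [/andP[tge tle]|_] := boolP (0 <= t <= 2 * pi)%R; last first.
    by rewrite /= mul0r mulr0 mulr_ge0// mulr_ge0// ltW.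
  rewrite /= mul1r mulrA ler_wpM2r// real_normK ?num_real// /poisson_kernel mulrA.
  rewrite ler_pdivrMr ?sqnormc_expiB_gt0//.
  have h1 : sqnormc (expi t - expi t0) <= (1 + alpha) ^+ 2 * sqnormc (expi t - z).
    rewrite -!sqr_normcE -exprMn ler_pXn2r ?nnegrE ?normc_ge0//; last first.
      by rewrite mulr_ge0 ?normc_ge0//; lra.
    rewrite (_ : expi t - expi t0 = (expi t - z) + (z - expi t0)); last by ring.
    rewrite (le_trans (ler_normcD _ _))// mulrDl mul1r lerD2l (le_trans (ltW zs))//.
    by rewrite ler_pM2l// normc_expiB_ge.
  have h2 := le_trans (hk t tge tle) h1.
  have h3 := one_sub_sqnormc_le z1.
  have h4 : 0 <= sqnormc (expi t - z) by exact: sqnormc_ge0.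
  have h5 : (t - t0) ^+ 2 <= (1 + alpha) ^+ 2 / k * sqnormc (expi t - z).
    by rewrite mulrAC ler_pdivlMr// mulrC.
  have h6 : 0 <= 1 - sqnormc z.
    by rewrite subr_ge0 -sqr_normcE exprn_ile1 ?normc_ge0// ltW.
  apply: (@le_trans _ _ ((1 + alpha) ^+ 2 / k * sqnormc (expi t - z) * (2 * (1 - normc z)))).
    by rewrite ler_pM// sqr_ge0.
  have -> : (1 + alpha) ^+ 2 / k * sqnormc (expi t - z) * (2 * (1 - normc z)) =
      (2 * (1 + alpha) ^+ 2 / k) * (1 - normc z) * sqnormc (expi t - z) by ring.
  by rewrite ler_wpM2r// ler_wpM2r ?(ltW dl0)// lerDr.
have -> : 9 * K * (e / (18 * K)) = e / 2 by field; rewrite gt_eqF.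
have h7 : K * (1 - normc z) / eta ^+ 2 * M <= e / 2.
  rewrite mulrAC ler_pdivrMr ?exprn_gt0//.
  have MK : 0 < 2 * K * (M + 1) by rewrite !mulr_gt0//; lra.
  move: zd; rewrite ltr_pdivlMr// => zd.
  have h8 : 0 <= K * (1 - normc z) by rewrite mulr_ge0// ltW.
  have h9 : (1 - normc z) * (2 * K * (M + 1)) =
      2 * (K * (1 - normc z) * M) + 2 * (K * (1 - normc z)) by ring.
  by rewrite h9 in zd; lra.
by rewrite -/M; lra.
Qed.

End fatou.

(** * Stolz regions, boundary limits and uniqueness of Fourier coefficients *)

Section nontangential.
Context {R : realType}.
Local Notation mu := (circle_prob R).
Implicit Types (z w : R[i]) (f : R -> R[i]).

Lemma complex_gt0 (e : R[i]) : 0 < e -> 0 < Re e /\ e = (Re e)%:C%C.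
Proof. by case: e => a b; rewrite ltcE/= => /andP[/eqP -> ?]. Qed.

Lemma stolzE (alpha : R) (zeta z : R[i]) :
  stolz alpha zeta z <-> normc (z - zeta) < alpha * (1 - normc z).
Proof.
rewrite /stolz /=.
have -> : `|z - zeta : R[i]^o| = (normc (z - zeta))%:C%C by [].
have -> : `|z : R[i]^o| = (normc z)%:C%C by [].
by rewrite -(rmorph1 (real_complex R)) -rmorphB -rmorphM ltcR.
Qed.

Lemma nontangentialP (F : R[i] -> R[i]) zeta w : nontangential_limit F zeta w <->
  forall alpha e : R, 1 < alpha -> 0 < e -> exists2 d, 0 < d & forall z,
    normc (z - zeta) < d -> normc (z - zeta) < alpha * (1 - normc z) ->
    normc (F z - w) <= e.
Proof.
split=> [H alpha e al1 e0|H alpha al1].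
  have e0' : 0 < e%:C%C by rewrite ltcR.
  have /cvgrPdist_le/(_ e%:C%C e0') := H alpha al1.
  rewrite near_withinE => /nbhs_ballP[d /= /complex_gt0[d0 dE] hd].
  exists (Re d) => // z zd zs.
  have : `|w - F z : R[i]^o| <= e%:C%C.
    apply: hd; last exact/stolzE.
    rewrite /ball/= dE; have -> : `|zeta - z : R[i]| = (normc (zeta - z))%:C%C by [].
    by rewrite ltcR normc_distC.
  have -> : `|w - F z : R[i]^o| = (normc (w - F z))%:C%C by [].
  by rewrite lecR normc_distC.
apply/cvgrPdist_le => e /complex_gt0[e0 ->].
have [d d0 hd] := H alpha (Re e) al1 e0.
rewrite near_withinE; apply/nbhs_ballP; exists d%:C%C; first by rewrite /= ltcR.
move=> z /= zd /stolzE zs.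
have -> : `|w - F z : R[i]^o| = (normc (w - F z))%:C%C by [].
rewrite lecR normc_distC; apply: hd => //.
move: zd; rewrite /ball/=; have -> : `|zeta - z : R[i]| = (normc (zeta - z))%:C%C by [].
by rewrite ltcR normc_distC.
Qed.

Lemma radius_in_stolz (t r : R) : 0 <= r < 1 ->
  normc (r%:C%C * expi t) = r /\ normc (r%:C%C * expi t - expi t) = 1 - r.
Proof.
move=> /andP[r0 r1]; split.
  by rewrite Normc.normcM normc_expi mulr1 normc_real ger0_norm.
rewrite -[X in _ - X]mul1r -mulrBl Normc.normcM normc_expi mulr1.
rewrite -(rmorph1 (real_complex R)) -rmorphB normc_real distrC ger0_norm//.
by rewrite subr_ge0 ltW.
Qed.

Lemma nontangential_radial (F : R[i] -> R[i]) (t : R) w :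
  nontangential_limit F (expi t) w -> forall e : R, 0 < e ->
  exists2 d, 0 < d & forall r, 0 <= r < 1 -> 1 - r < d ->
    normc (F (r%:C%C * expi t) - w) <= e.
Proof.
move=> /nontangentialP H e e0; have [d d0 hd] := H 2 e (ltr1n _ _) e0.
exists d => // r r01 rd; have [h1 h2] := radius_in_stolz t r01.
by case/andP: r01 => r0 r1; apply: hd; rewrite h2// h1; lra.
Qed.

Lemma Re_poisson f z : Re (poisson f z) = \int[mu]_t (poisson_kernel z t * Re (f t)).
Proof. by apply: eq_Rintegral => t _; rewrite cReM /= mul0r subr0. Qed.

Lemma Im_poisson f z : Im (poisson f z) = \int[mu]_t (poisson_kernel z t * Im (f t)).
Proof. by apply: eq_Rintegral => t _; rewrite cImM /= mul0r addr0. Qed.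

Lemma poisson_nontangential f : cL1 mu f ->
  {ae mu, forall t, nontangential_limit (poisson f) (expi t) (f t)}.
Proof.
move=> [r1 r2]; have h := ae_imply2 (fun t => @conj _ _)
  (ae_circle_lebesgue_pt r1) (ae_circle_lebesgue_pt r2).
apply: (ae_imply2 _ h (@circle_ae_itv R)) => {h} t [l1 l2] tI.
apply/nontangentialP => alpha e al1 e0.
have al0 : 0 < alpha by lra.
have e20 : 0 < e / 2 by lra.
have [d1 d10 h1] := real_fatou r1 tI l1 al0 e20.
have [d2 d20 h2] := real_fatou r2 tI l2 al0 e20.
exists (Num.min d1 d2); first by rewrite lt_min d10.
move=> z; rewrite lt_min => /andP[z1 z2] zs.
have zle : 1 - normc z <= normc (z - expi t) by rewrite normc_distC normc_expiB_ge.
rewrite (le_trans (normc_le_ReIm _))// cReD cImD cReN cImN Re_poisson Im_poisson.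
have := h1 z zs (le_lt_trans zle z1); have := h2 z zs (le_lt_trans zle z2) => /=; lra.
Qed.

(** The Poisson integral of [f] vanishes on the whole disc, and its radial limits are the values of
    [f]. *)
Lemma fourier_unique f : cL1 mu f ->
  (forall n, (0 < n)%N -> ncoef f n = 0) -> (forall n, fcoef f n = 0) ->
  {ae mu, forall t, f t = 0}.
Proof.
move=> lf f1 f2; apply: (ae_imply _ (poisson_nontangential lf)) => t h.
apply/eqP; rewrite -normc_eq0 eq_le normc_ge0 andbT; apply/ler_addgt0Pr => e e0.
rewrite add0r; have [d d0 hd] := nontangential_radial h e0.
pose r := Num.max 0 (1 - d / 2).
have r01 : 0 <= r < 1 by rewrite le_max lexx/= gt_max; apply/andP; split; lra.
have rd : 1 - r < d.
  have : 1 - d / 2 <= r by rewrite le_max lexx orbT.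
  lra.
have := hd r r01 rd; rewrite poisson_eq0//; first by rewrite sub0r normcNE.
by have [-> _] := radius_in_stolz t r01; case/andP: r01.
Qed.

End nontangential.

(** * The space H^2 in terms of Fourier coefficients *)

Section hardy.
Context {R : realType}.
Local Notation mu := (circle_prob R).
Implicit Types (z w : R[i]) (f g : R -> R[i]).

Definition hardy f := cL2 mu f /\ forall n, (0 < n)%N -> ncoef f n = 0.

Lemma cL2_expiX n : cL2 mu (fun t => expi t ^+ n).
Proof.
apply: (cL2_le (u := fun=> 1)); [exact: cmf_expiX| |exact: rint_cst].
by move=> t; rewrite -sqr_normcE normc_expiX expr1n.
Qed.

Lemma cL2_trig (a : nat -> R[i]) n :
  cL2 mu (fun t => \sum_(0 <= k < n) a k * expi t ^+ k).
Proof.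
elim: n => [|n IH].
  rewrite (_ : (fun _ => _) = fun=> 0); first exact: cL2_cst.
  by apply/funext => t; rewrite big_nil.
rewrite (_ : (fun _ => _) =
    fun t => \sum_(0 <= k < n) a k * expi t ^+ k + a n * expi t ^+ n).
  by apply: cL2D => //; apply: cL2Z; exact: cL2_expiX.
by apply/funext => t; rewrite big_nat_recr.
Qed.

Lemma expiX_mulJ0 (t : R) n : expi t ^+ n * (expi t ^+ n)^* = 1.
Proof. by rewrite mulcJE -sqr_normcE normc_expiX expr1n. Qed.

Lemma expiX_mulJ (t : R) m n : (m < n)%N ->
  expi t ^+ m * (expi t ^+ n)^* = (expi t ^+ (n - m))^*.
Proof.
move=> mn; rewrite -{1}(subnK (ltnW mn)) exprD rmorphM/= mulrCA.
by rewrite expiX_mulJ0 mulr1.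
Qed.

Lemma cint_trig_expiXJ (a : nat -> R[i]) n m : (n <= m)%N ->
  cint mu (fun t => (\sum_(0 <= k < n) a k * expi t ^+ k) * (expi t ^+ m)^*) = 0.
Proof.
elim: n => [_|n IH nm].
  rewrite (_ : (fun _ => _) = fun=> 0); first by rewrite cint_cst.
  by apply/funext => t; rewrite big_nil mul0r.
have lm : cL2 mu (fun t => (expi t ^+ m)^*) by apply: cL2J; exact: cL2_expiX.
rewrite (_ : (fun _ => _) = fun t =>
    (\sum_(0 <= k < n) a k * expi t ^+ k) * (expi t ^+ m)^* +
    a n * (expi t ^+ (m - n))^*).
  rewrite cintD ?IH ?add0r//.
  - have le : cL1 mu (fun t => expi t ^+ (m - n)) by apply: cL2_cL1; exact: cL2_expiX.
    rewrite cintZ ?cintJ//; last exact: cL1J.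
    by rewrite cint_expiX ?subn_gt0// rmorph0 mulr0.
  - exact: ltnW.
  - by apply: cL2_mul => //; exact: cL2_trig.
  - by apply: cL1Z; apply: cL1J; apply: cL2_cL1; exact: cL2_expiX.
by apply/funext => t; rewrite big_nat_recr//= mulrDl -mulrA expiX_mulJ.
Qed.

Lemma nsq_expiX n : nsq mu (fun t => expi t ^+ n) = 1.
Proof.
rewrite /nsq -[RHS](rintegral_cst mu); apply: eq_Rintegral => t _.
by rewrite -sqr_normcE normc_expiX expr1n.
Qed.

Lemma nsq_trig (a : nat -> R[i]) n :
  nsq mu (fun t => \sum_(0 <= k < n) a k * expi t ^+ k) =
  \sum_(0 <= k < n) sqnormc (a k).
Proof.
elim: n => [|n IH].
  rewrite big_nil /nsq -[RHS](rintegral_cst mu); apply: eq_Rintegral => t _.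
  by rewrite big_nil -sqr_normcE Normc.normc0 expr0n.
rewrite big_nat_recr//= -IH (_ : (fun t => \sum_(0 <= k < n.+1) _) =
    fun t => \sum_(0 <= k < n) a k * expi t ^+ k - (- a n) * expi t ^+ n).
  rewrite nsqBZ; [|exact: cL2_trig|exact: cL2_expiX].
  by rewrite cint_trig_expiXJ// mulr0 mulr0 subr0 nsq_expiX mulr1 sqnormcN.
by apply/funext => t; rewrite big_nat_recr//= mulNr opprK.
Qed.

Lemma bessel f n : cL2 mu f -> \sum_(0 <= k < n) sqnormc (fcoef f k) <= nsq mu f.
Proof.
move=> lf; rewrite -subr_ge0.
suff -> : nsq mu f - \sum_(0 <= k < n) sqnormc (fcoef f k) =
  nsq mu (fun t => f t - \sum_(0 <= k < n) fcoef f k * expi t ^+ k) by exact: nsq_ge0.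
elim: n => [|n IH].
  rewrite big_nil subr0; congr nsq; apply/funext => t.
  by rewrite big_nil subr0.
rewrite big_nat_recr//= opprD addrA IH.
rewrite [in RHS](_ : (fun t => _) = fun t => (f t -
    \sum_(0 <= k < n) fcoef f k * expi t ^+ k) - fcoef f n * expi t ^+ n).
  rewrite nsqBZ; [|by apply: cL2B => //; exact: cL2_trig|exact: cL2_expiX].
  rewrite nsq_expiX mulr1; pose S t := \sum_(0 <= k < n) fcoef f k * expi t ^+ k.
  have lm : cL2 mu (fun t => (expi t ^+ n)^*) by apply: cL2J; exact: cL2_expiX.
  have -> : cint mu (fun t => (f t - S t) * (expi t ^+ n)^*) = fcoef f n.
    rewrite (_ : (fun _ => _) = fun t => f t * (expi t ^+ n)^* - S t * (expi t ^+ n)^*).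
      rewrite cintB; [|by apply: cL2_mul|by apply: cL2_mul => //; exact: cL2_trig].
      rewrite cint_trig_expiXJ// subr0; congr cint; apply/funext => t.
      by rewrite rmorphXn.
    by apply/funext => t; rewrite mulrBl.
  by rewrite [_^* * _]mulrC mulcJE /=; lra.
by apply/funext => t; rewrite big_nat_recr//= opprD addrA.
Qed.

Lemma cvg_normcP (a : nat -> R[i]) w :
  normc (a n - w) @[n --> \oo] --> (0 : R) <-> (a : nat -> R[i]^o) @ \oo --> (w : R[i]^o).
Proof.
split=> H.
  apply/cvgrPdist_le => e /complex_gt0[e0 ->].
  move/cvgrPdist_le : H => /(_ _ e0); apply: filterS => n.
  rewrite sub0r normrN ger0_norm ?normc_ge0// normc_distC => h.
  have -> : `|w - a n : R[i]^o| = (normc (w - a n))%:C%C by [].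
  by rewrite lecR.
apply/cvgrPdist_le => e e0; have e0' : 0 < e%:C%C by rewrite ltcR.
move/cvgrPdist_le : H => /(_ _ e0'); apply: filterS => n.
have -> : `|w - a n : R[i]^o| = (normc (w - a n))%:C%C by [].
by rewrite lecR sub0r normrN ger0_norm ?normc_ge0// normc_distC.
Qed.

Lemma cvg_ReIm (a : nat -> R[i]) w : normc (a n - w) @[n --> \oo] --> (0 : R) ->
  (Re (a n) @[n --> \oo] --> Re w) /\ (Im (a n) @[n --> \oo] --> Im w).
Proof.
move=> H; split; apply/cvgrPdist_le => e e0;
  move/cvgrPdist_le : H => /(_ _ e0); apply: filterS => n;
  rewrite sub0r normrN ger0_norm ?normc_ge0// => h; apply: le_trans h.
- by rewrite distrC -cReN -cReD normr_Re_le.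
- by rewrite distrC -cImN -cImD normr_Im_le.
Qed.

Lemma cmf_cvg (F : nat -> R -> R[i]) f :
  (forall n, @cmf _ (measurableTypeR R) _ (F n)) ->
  (forall t, normc (F n t - f t) @[n --> \oo] --> (0 : R)) ->
  @cmf _ (measurableTypeR R) _ f.
Proof.
move=> mF Ff; split.
- apply: (measurable_fun_cvg (h := fun n => Re \o F n)) => [n|t _].
    by have [] := mF n.
  by have [] := cvg_ReIm (Ff t).
- apply: (measurable_fun_cvg (h := fun n => Im \o F n)) => [n|t _].
    by have [] := mF n.
  by have [] := cvg_ReIm (Ff t).
Qed.

Lemma sqnormc_cvg (a : nat -> R[i]) w : normc (a n - w) @[n --> \oo] --> (0 : R) ->
  sqnormc (a n) @[n --> \oo] --> sqnormc w.
Proof.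
move=> /cvg_ReIm[h1 h2]; rewrite /Defs.sqnormc !expr2.
apply: cvgD; [exact (cvgM h1 h1)|exact (cvgM h2 h2)].
Qed.

Section dilate.
Variables (a : nat -> R[i]) (F : R[i] -> R[i]) (r : R).
Hypotheses (r0 : 0 <= r) (r1 : r < 1).
Hypothesis Fa : forall z, normc z < 1 ->
  normc (series (fun n => a n * z ^+ n) n - F z) @[n --> \oo] --> (0 : R).

Let S n (t : R) := \sum_(0 <= k < n) (a k * r%:C%C ^+ k) * expi t ^+ k.

Lemma cvg_dilate (t : R) : normc (S n t - F (r%:C%C * expi t)) @[n --> \oo] --> (0 : R).
Proof.
have [h _] := radius_in_stolz t (introT andP (conj r0 r1)).
have /Fa : normc (r%:C%C * expi t) < 1 by rewrite h.
rewrite (_ : (fun n => _) = fun n => normc (S n t - F (r%:C%C * expi t)))//.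
apply/funext => n; congr (normc (_ - _)); apply: eq_bigr => k _.
by rewrite exprMn mulrA.
Qed.

(** [F] is known only as a pointwise sum on the disc, so measurability is inherited from the
    trigonometric partial sums. *)
Lemma cmf_dilate : @cmf _ (measurableTypeR R) _ (fun t => F (r%:C%C * expi t)).
Proof.
apply: (cmf_cvg (F := S)) => [n|t]; last exact: cvg_dilate.
exact: cL2_meas (cL2_trig _ n).
Qed.

End dilate.

(** The partial sums on the circle of radius [r] have square norm bounded by [nsq mu f], by Bessel's
    inequality and [r < 1]; Fatou's lemma gives the same bound for the sum. *)
Lemma hardy_poisson_disc f : hardy f -> hardy2_disc (poisson f).
Proof.
move=> [lf f0]; have l1 := cL2_cL1 lf.
have Fa z : normc z < 1 ->
    normc (series (fun n => fcoef f n * z ^+ n) n - poisson f z) @[n --> \oo] --> (0 : R).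
  move=> z1; have := cvg_poisson_series l1 z1 f0.
  rewrite (_ : (fun n => z ^+ n * fcoef f n) = (fun n => fcoef f n * z ^+ n))//.
  by apply/funext => n; rewrite mulrC.
split.
  exists (fcoef f) => z z1; apply/cvg_normcP; apply: Fa.
  by move: z1; rewrite (_ : `|z| = (normc z)%:C%C)// -(rmorph1 (real_complex R)) ltcR.
exists (nsq mu f) => r /andP[r0 r1].
pose S n (t : R) := \sum_(0 <= k < n) (fcoef f k * r%:C%C ^+ k) * expi t ^+ k.
have [] := @rint_fatou _ _ _ mu (fun n t => sqnormc (S n t))
  (fun t => sqnormc (poisson f (r%:C%C * expi t))) (nsq mu f).
- by move=> n; have [] := cL2_trig (fun k => fcoef f k * r%:C%C ^+ k) n.
- by move=> n t; exact: sqnormc_ge0.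
- move=> n; rewrite [leLHS](nsq_trig (fun k => fcoef f k * r%:C%C ^+ k)).
  apply: le_trans (bessel n lf); apply: ler_sum => k _.
  rewrite sqnormcM ler_piMr ?sqnormc_ge0// -sqr_normcE normcX normc_real.
  by rewrite (ger0_norm (ltW r0)) -exprM exprn_ile1 ?(ltW r0) ?(ltW r1).
- by apply: measurable_sqnormc; apply: (cmf_dilate (ltW r0) r1 Fa).
- by move=> t; exact: sqnormc_ge0.
- by apply: aeW => t; apply: sqnormc_cvg; exact: (cvg_dilate (ltW r0) r1 Fa).
move=> rP leP; rewrite rint_EFin// lee_fin.
Qed.

Lemma hardy_H2 f : hardy f -> H2 f.
Proof.
move=> hf; have [lf _] := hf; split; first exact/L2P.
by exists (poisson f); split;
  [exact: hardy_poisson_disc|exact: poisson_nontangential (cL2_cL1 lf)].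
Qed.

End hardy.

Section L2_bounded.
Context {d} {T : measurableType d} {R : realType} (P : probability T R).

(* Truncation: [x <= min x K + x ^+ 2 / K]. *)
Lemma cvg_rint_of_bounded_sqr (U : nat -> T -> R) B :
  (forall n, rint P (U n)) -> (forall n t, 0 <= U n t) ->
  (forall n, rint P (fun t => U n t ^+ 2)) ->
  (forall n, \int[P]_t (U n t ^+ 2) <= B) ->
  {ae P, forall t, U n t @[n --> \oo] --> (0 : R)} ->
  \int[P]_t U n t @[n --> \oo] --> (0 : R).
Proof.
move=> rU U0 rU2 U2B Ut; apply/cvgrPdist_le => e e0.
have B0 : 0 <= B.
  by apply: le_trans (U2B 0%N); apply: Rintegral_ge0 => t _; exact: sqr_ge0.
(* This level makes the tail [B / K] at most [e / 2]; the truncated part is dominated by the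
   constant [K]. *)
pose K := 2 * (B + 1) / e.
have K0 : 0 < K by rewrite divr_gt0// mulr_gt0//; lra.
pose m n t := Num.min (U n t) K.
have mU n : measurable_fun setT (U n) := rint_meas (rU n).
have mm n : measurable_fun setT (m n) by apply: measurable_minr.
have m0 n t : 0 <= m n t by rewrite le_min U0 ltW.
have rm n : rint P (m n).
  apply: (rint_le (mm n) _ (rU n)) => t.
  by rewrite ger0_norm// ge_min lexx.
have mcvg : \int[P]_t m n t @[n --> \oo] --> (0 : R).
  have [] := @dominated_convergence _ _ _ P setT measurableT
    (fun n => EFin \o m n) (cst 0%E) (cst K%:E).
  - by move=> n; apply/measurable_EFinP.
  - exact: measurable_cst.
  - apply: (ae_imply _ Ut) => t Utt _.
    have h : m n t @[n --> \oo] --> (0 : R).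
      apply: (@squeeze_cvgr _ _ _ _ (fun=> 0) (fun n => U n t)) => //.
        by apply: nearW => n; rewrite m0 ge_min lexx.
      exact: cvg_cst.
    by apply: cvg_EFin; [exact: nearW|exact: h].
  - exact: rint_cst.
  - apply: aeW => t n _ /=; rewrite lee_fin ger0_norm// ge_min lexx orbT//.
  move=> _ _; rewrite integral0 => /fine_cvg; exact.
move/cvgrPdist_le : mcvg => /(_ (e / 2)) h.
have e2 : 0 < e / 2 by lra.
move: (h e2); apply: filterS => n; rewrite !sub0r !normrN !ger0_norm; last 2 first.
- by apply: Rintegral_ge0.
- by apply: Rintegral_ge0.
move=> hn.
have : \int[P]_t U n t <= \int[P]_t (m n t + K^-1 * U n t ^+ 2).
  apply: rintegral_le => //; first by apply: rintD => //; exact: rintZ.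
  move=> t; rewrite /m; have [h1|h1] := leP (U n t) K.
    by rewrite lerDl mulr_ge0 ?sqr_ge0// invr_ge0 ltW.
  have : U n t <= K^-1 * U n t ^+ 2.
    by rewrite mulrC ler_pdivlMr// expr2 ler_wpM2l// ltW.
  lra.
rewrite RintegralD//; [|exact: rm|exact: rintZ].
rewrite RintegralZl//; last exact: rU2.
move=> /le_trans; apply.
have -> : e = e / 2 + e / 2 by field.
apply: lerD => //; rewrite mulrC ler_pdivrMr// (le_trans (U2B n))//.
have -> : e / 2 * K = B + 1 by rewrite /K; field; rewrite gt_eqF.
lra.
Qed.

End L2_bounded.

(** * From the Hardy space of the disc to Fourier coefficients *)

Section H2_hardy.
Context {R : realType}.
Local Notation mu := (circle_prob R).
Implicit Types (z w : R[i]) (f g : R -> R[i]).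

(** The terms of the convergent series at the point [rho] tend to 0, hence are bounded. *)
Lemma power_series_bound (a : nat -> R[i]) (F : R[i] -> R[i]) (rho : R) :
  0 <= rho -> rho < 1 ->
  (forall z, normc z < 1 ->
    normc (series (fun n => a n * z ^+ n) n - F z) @[n --> \oo] --> (0 : R)) ->
  exists C, forall n, normc (a n) * rho ^+ n <= C.
Proof.
move=> r0 r1 Fa; have nr : normc rho%:C%C = rho by rewrite normc_real ger0_norm.
have /cvg_normcP h : normc (series (fun n => a n * rho%:C%C ^+ n) n - F rho%:C%C)
    @[n --> \oo] --> (0 : R) by apply: Fa; rewrite nr.
have /cvg_series_cvg_0 /cvg_normcP h0 : cvgn (series (fun n => a n * rho%:C%C ^+ n) : nat -> R[i]^o).
  by apply/cvg_ex; exists (F rho%:C%C).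
have h1 : normc (a n * rho%:C%C ^+ n) @[n --> \oo] --> (0 : R).
  move: h0; rewrite (_ : (fun n => normc (a n * rho%:C%C ^+ n - 0)) =
    fun n => normc (a n * rho%:C%C ^+ n))//.
  by apply/funext => n; rewrite subr0.
have [C [_ hC]] := cvg_seq_bounded (cvgP _ h1).
exists (C + 1) => n; have C1 : C < C + 1 by rewrite ltrDl.
have := hC (C + 1) C1 n I; rewrite /= ger0_norm ?normc_ge0//.
by rewrite Normc.normcM normcX nr.
Qed.

Lemma sum_geometric_le (q : R) m n : 0 <= q -> q < 1 ->
  \sum_(m <= k < m + n) q ^+ k <= q ^+ m / (1 - q).
Proof.
move=> q0 q1; have q1' : 0 < 1 - q by rewrite subr_gt0.
suff -> : \sum_(m <= k < m + n) q ^+ k = (q ^+ m - q ^+ (m + n)) / (1 - q).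
  by rewrite ler_pM2r ?invr_gt0// gerBl exprn_ge0.
elim: n => [|n IH]; first by rewrite addn0 big_geq// subrr mul0r.
rewrite addnS big_nat_recr ?leq_addr//= IH exprS; field.
by rewrite gt_eqF.
Qed.

Section dilate_uniform.
Variables (a : nat -> R[i]) (F : R[i] -> R[i]) (r rho C : R).
Hypotheses (r0 : 0 <= r) (rrho : r < rho) (rho1 : rho < 1).
Hypothesis Fa : forall z, normc z < 1 ->
  normc (series (fun n => a n * z ^+ n) n - F z) @[n --> \oo] --> (0 : R).
Hypothesis aC : forall n, normc (a n) * rho ^+ n <= C.

Let S n (t : R) := \sum_(0 <= k < n) (a k * r%:C%C ^+ k) * expi t ^+ k.
Let q := r / rho.

(** Comparison with a geometric series of ratio [q = r / rho]. The bound is uniform in [t], so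
    negative coefficients, null for the partial sums, are null for the dilate. *)
Lemma dilate_uniform n (t : R) :
  normc (S n t - F (r%:C%C * expi t)) <= C * (q ^+ n / (1 - q)).
Proof.
have rho0 : 0 < rho := le_lt_trans r0 rrho.
have q0 : 0 <= q by rewrite divr_ge0// ltW.
have q1 : q < 1 by rewrite ltr_pdivrMr// mul1r.
have C0 : 0 <= C by rewrite (le_trans _ (aC 0%N))// mulr_ge0 ?normc_ge0// exprn_ge0// ltW.
have r1 : r < 1 := lt_trans rrho rho1.
have ak k : normc (a k * r%:C%C ^+ k * expi t ^+ k) <= C * q ^+ k.
  rewrite !Normc.normcM normc_expiX mulr1 normcX normc_real ger0_norm//.
  have -> : r ^+ k = rho ^+ k * q ^+ k by rewrite -exprMn mulrC divfK// gt_eqF.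
  by rewrite mulrA ler_wpM2r// exprn_ge0.
have SS m : normc (S (n + m) t - S n t) <= C * (q ^+ n / (1 - q)).
  apply: (@le_trans _ _ (\sum_(n <= k < n + m) C * q ^+ k)); last first.
    by rewrite -mulr_sumr ler_wpM2l// sum_geometric_le.
  rewrite /S (@big_cat_nat _ _ _ n 0 (n + m))//= ?leq_addr// addrAC subrr add0r.
  elim: m => [|m IH]; first by rewrite addn0 !big_geq// Normc.normc0.
  rewrite addnS !big_nat_recr ?leq_addr//= (le_trans (ler_normcD _ _))//.
  exact: lerD.
have cS := cvg_dilate r0 r1 Fa t.
rewrite -subr_le0; apply: (cvgr_to_ge cS); exists n => // m /= nm.
rewrite lerBlDr -(subnKC nm) (le_trans _ (lerD (lexx _) (SS (m - n)%N)))//.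
rewrite -[X in normc X <= _](_ : (S (n + (m - n)) t - F (r%:C%C * expi t)) -
  (S (n + (m - n)) t - S n t) = _); first exact: ler_normcB.
by ring.
Qed.

Hypothesis lF : cL2 mu (fun t => F (r%:C%C * expi t)).

Lemma cint_trig_expiX (c : nat -> R[i]) N n : (0 < n)%N ->
  cint mu (fun t => (\sum_(0 <= k < N) c k * expi t ^+ k) * expi t ^+ n) = 0.
Proof.
move=> n0; elim: N => [|N IH].
  rewrite (_ : (fun _ => _) = fun=> 0); first by rewrite cint_cst.
  by apply/funext => t; rewrite big_nil mul0r.
have le : cL1 mu (fun t => expi t ^+ (N + n)) by apply: cL2_cL1; exact: cL2_expiX.
rewrite (_ : (fun _ => _) = fun t =>
    (\sum_(0 <= k < N) c k * expi t ^+ k) * expi t ^+ n + c N * expi t ^+ (N + n)).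
  rewrite cintD ?IH ?add0r.
  - by rewrite cintZ// cint_expiX ?mulr0// addn_gt0 n0 orbT.
  - by apply: cL2_mul; [exact: cL2_trig|exact: cL2_expiX].
  - exact: cL1Z.
by apply/funext => t; rewrite big_nat_recr//= mulrDl exprD mulrA.
Qed.

Lemma ncoef_dilate n : (0 < n)%N -> ncoef (fun t => F (r%:C%C * expi t)) n = 0.
Proof.
move=> n0; have rho0 : 0 < rho := le_lt_trans r0 rrho.
have q0 : 0 <= q by rewrite divr_ge0// ltW.
have q1 : q < 1 by rewrite ltr_pdivrMr// mul1r.
have le N : normc (ncoef (fun t => F (r%:C%C * expi t)) n) <= C * (q ^+ N / (1 - q)).
  rewrite -[ncoef _ _]subr0 -[X in _ - X](cint_trig_expiX (fun k => a k * r%:C%C ^+ k) N n0).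
  have lS : cL2 mu (S N) by exact: cL2_trig.
  rewrite /ncoef -cintB; [|by apply: cL2_mul => //; exact: cL2_expiX..].
  rewrite (_ : (fun _ => _) = fun t => (F (r%:C%C * expi t) - S N t) * expi t ^+ n); last first.
    by apply/funext => t; rewrite mulrBl.
  have l1 : cL1 mu (fun t => (F (r%:C%C * expi t) - S N t) * expi t ^+ n).
    by apply: cL2_mul; [exact: cL2B|exact: cL2_expiX].
  rewrite (le_trans (normc_cint_le l1))// -[leRHS](rintegral_cst mu).
  apply: rintegral_le; [exact: cL1_normc l1|exact: rint_cst|move=> t].
  by rewrite Normc.normcM normc_expiX mulr1 normc_distC dilate_uniform.
apply/eqP; rewrite -normc_eq0 eq_le normc_ge0 andbT.
have h : C * (q ^+ N / (1 - q)) @[N --> \oo] --> (0 : R).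
  rewrite -[X in _ --> X](mulr0 C); apply: cvgM; first exact: cvg_cst.
  rewrite -[X in _ --> X](mul0r (1 - q)^-1); apply: cvgM; last exact: cvg_cst.
  have := @cvg_geometric R 1 q; rewrite ger0_norm// => /(_ q1).
  rewrite (_ : geometric 1 q = fun n => q ^+ n)//.
  by apply/funext => k; rewrite /= mul1r.
by apply: (cvgr_to_ge h); exact: nearW.
Qed.

End dilate_uniform.

(** The dilates are bounded in [L^2] and converge almost everywhere along radii, so they converge in
    [L^1], which is enough to carry the vanishing coefficients to [f]. *)
Lemma H2_hardy f : H2 f -> hardy f.
Proof.
move=> [/L2P lf [F [[[a Fa] [M FM]] Ff]]]; split => // n n0.
have {}Fa z : normc z < 1 ->
    normc (series (fun n => a n * z ^+ n) n - F z) @[n --> \oo] --> (0 : R).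
  move=> z1; apply/cvg_normcP; apply: Fa.
  by rewrite (_ : `|z : R[i]^o| = (normc z)%:C%C)// -(rmorph1 (real_complex R)) ltcR.
(* The shift by 2 keeps the radius strictly between 0 and 1 already for [m = 0]. *)
pose r m : R := 1 - (m.+2%:R)^-1.
have r01 m : 0 < r m < 1.
  by rewrite /r subr_gt0 invf_lt1// ltr1n/= gtrBl invr_gt0.
pose G m (t : R) := F ((r m)%:C%C * expi t).
have mG m : @cmf _ (measurableTypeR R) _ (G m).
  by case/andP: (r01 m) => /ltW h0 h1; exact: cmf_dilate h0 h1 Fa.
have lG m : cL2 mu (G m).
  split => //; apply/integrableP; split.
    by apply/measurable_EFinP; exact: measurable_sqnormc.
  rewrite (le_lt_trans _ (ltry M))// (le_trans _ (FM _ (r01 m)))// le_eqVlt.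
  apply/orP; left; apply/eqP; apply: eq_integral => t _ /=.
  by rewrite ger0_norm ?sqnormc_ge0.
have GM m : nsq mu (G m) <= M.
  by rewrite -lee_fin -rint_EFin; [exact: FM|have [] := lG m].
have G0 m : ncoef (G m) n = 0.
  case/andP: (r01 m) => /ltW h0 h1; pose rho := (1 + r m) / 2.
  have rr : r m < rho by rewrite /rho; lra.
  have rho1 : rho < 1 by rewrite /rho; lra.
  have rho0 : 0 <= rho by rewrite /rho; lra.
  have [C hC] := power_series_bound rho0 rho1 Fa.
  exact: (ncoef_dilate h0 rr rho1 Fa hC (lG m) n0).
have lD m : cL2 mu (fun t => G m t - f t) by exact: cL2B.
have h : \int[mu]_t normc (G m t - f t) @[m --> \oo] --> (0 : R).
  apply: (@cvg_rint_of_bounded_sqr _ _ _ mu _ (2 * M + 2 * nsq mu f)).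
  - by move=> m; apply: cL1_normc; exact: cL2_cL1.
  - by move=> m t; exact: normc_ge0.
  - move=> m; have [_] := lD m; rewrite /rint.
    rewrite (_ : EFin \o (sqnormc \o _) = EFin \o (fun t => normc (G m t - f t) ^+ 2))//.
    by apply/funext => t /=; rewrite sqr_normcE.
  - move=> m; rewrite (_ : Rintegral _ _ _ = nsq mu (fun t => G m t - f t)).
      by rewrite (le_trans (nsqD_le (lG m) (cL2N lf)))// nsqN lerD2r ler_pM2l.
    by apply: eq_Rintegral => t _; rewrite sqr_normcE.
  - apply: (ae_imply _ Ff) => t ht; apply/cvgrPdist_le => e e0.
    have [d d0 hd] := nontangential_radial ht e0.
    have : \forall m \near \oo, `|0 - (m.+1%:R)^-1 : R| < d.
      by apply: cvgr_dist_lt => //; exact: cvg_harmonic.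
    apply: filterS => m hm; rewrite sub0r normrN ger0_norm ?normc_ge0//.
    case/andP: (r01 m) => h0 h1; apply: hd; first by rewrite ltW.
    rewrite /r subKr; apply: le_lt_trans hm.
    by rewrite sub0r normrN ger0_norm// lef_pV2 ?posrE// ler_nat.
apply/eqP; rewrite -normc_eq0 eq_le normc_ge0 andbT.
apply: (cvgr_to_ge h); apply: nearW => m.
have le : cL2 mu (fun t => expi t ^+ n) by exact: cL2_expiX.
rewrite -[ncoef f n]subr0 -(G0 m) normc_distC /ncoef -cintB; [|exact: cL2_mul..].
rewrite (_ : (fun _ => _) = fun t => (G m t - f t) * expi t ^+ n); last first.
  by apply/funext => t; rewrite mulrBl.
have l1 : cL1 mu (fun t => (G m t - f t) * expi t ^+ n) by exact: cL2_mul.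
rewrite (le_trans (normc_cint_le l1))//.
apply: rintegral_le; [exact: cL1_normc l1|exact/cL1_normc/cL2_cL1|move=> t].
by rewrite Normc.normcM normc_expiX mulr1.
Qed.

End H2_hardy.

(** * Inner-outer factorization *)

Section hardy_space.
Context {R : realType}.
Local Notation mu := (circle_prob R).
Implicit Types (f g h k : R -> R[i]) (p q : {poly R[i]}).

Definition ptrig p (t : R) : R[i] := p.[expi t].

Lemma hardy_cL2 f : hardy f -> cL2 mu f. Proof. by case. Qed.

Lemma cL2_mulX f n : cL2 mu f -> cL2 mu (fun t => f t * expi t ^+ n).
Proof.
move=> lf; rewrite (_ : (fun _ => _) = fun t => expi t ^+ n * f t).
  apply: (cL2_bounded (M := 1)) => //; first exact: cmf_expiX.
  by move=> t; rewrite normc_expiX.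
by apply/funext => t; rewrite mulrC.
Qed.

Lemma hardy_ae_eq f g : cmf (g : measurableTypeR R -> _) ->
  {ae mu, forall t, f t = g t} -> hardy f -> hardy g.
Proof.
move=> mg fg [lf f0]; have lg := cL2_ae_eq mg fg lf; split => // n n0.
rewrite -(f0 n n0) /ncoef; apply: cint_ae_eq.
- exact: cL2_meas (cL2_mulX _ lg).
- exact: cL2_meas (cL2_mulX _ lf).
- by apply: (ae_imply _ fg) => t ->.
Qed.

Lemma hardy_lin f g c : hardy f -> hardy g -> hardy (fun t => f t + c * g t).
Proof.
move=> [lf f0] [lg g0]; split; first by apply: cL2D => //; exact: cL2Z.
move=> n n0; have lfn := cL2_cL1 (cL2_mulX n lf); have lgn := cL2_cL1 (cL2_mulX n lg).
rewrite /ncoef (_ : (fun _ => _) =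
    fun t => f t * expi t ^+ n + c * (g t * expi t ^+ n)).
  rewrite cintD ?cintZ//; last exact: cL1Z.
  by rewrite [cint _ _](f0 n n0) [cint _ _](g0 n n0) mulr0 addr0.
by apply/funext => t; rewrite mulrDl mulrA.
Qed.

Lemma hardy_closed (s : nat -> R -> R[i]) f : (forall n, hardy (s n)) -> cL2 mu f ->
  nsq mu (fun t => s n t - f t) @[n --> \oo] --> (0 : R) -> hardy f.
Proof.
move=> hs lf sf; split => // n n0.
have le := @cL2_expiX R n.
apply: (cvg_dist_unique (cvg_cint_mul (fun m => hardy_cL2 (hs m)) lf le sf)).
by apply: nearW => m; have [_] := hs m; exact.
Qed.

Lemma cint_ptrig_mul p g : cL2 mu g -> cint mu (fun t => ptrig p t * g t) =
  \sum_(i < size p) p`_i * cint mu (fun t => g t * expi t ^+ i).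
Proof.
move=> lg; rewrite /ptrig; under [in LHS]eq_fun do rewrite horner_coef.
elim: (size p) => [|n IH].
  rewrite big_ord0 (_ : (fun _ => _) = fun=> 0); first exact: cint_cst.
  by apply/funext => t; rewrite big_ord0 mul0r.
rewrite big_ord_recr/= -IH (_ : (fun _ => _) = fun t =>
    (\sum_(i < n) p`_i * expi t ^+ i) * g t + p`_n * (g t * expi t ^+ n)).
  rewrite cintD ?cintZ//; first exact: cL2_cL1 (cL2_mulX _ lg).
  - apply: cL2_mul => //; under eq_fun do rewrite -(big_mkord xpredT (fun i => p`_i * expi _ ^+ i)).
    exact: cL2_trig.
  - by apply: cL1Z; exact: cL2_cL1 (cL2_mulX _ lg).
by apply/funext => t; rewrite big_ord_recr/= mulrDl; ring.
Qed.

Lemma cmf_ptrig p : cmf (ptrig p : measurableTypeR R -> _).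
Proof.
rewrite (_ : ptrig p = fun t => \sum_(0 <= i < size p) p`_i * expi t ^+ i).
  exact: cL2_meas (cL2_trig _ _).
by apply/funext => t; rewrite /ptrig horner_coef big_mkord.
Qed.

Lemma ptrig_bounded p : exists M, forall t, normc (ptrig p t) <= M.
Proof.
exists (\sum_(i < size p) normc p`_i) => t; rewrite /ptrig horner_coef.
elim: (size p) => [|n IH]; first by rewrite !big_ord0 Normc.normc0.
rewrite !big_ord_recr/= (le_trans (ler_normcD _ _))// lerD//.
by rewrite Normc.normcM normc_expiX mulr1.
Qed.

Lemma cL2_ptrig_mul p g : cL2 mu g -> cL2 mu (fun t => ptrig p t * g t).
Proof.
by move=> lg; have [M hM] := ptrig_bounded p; exact: cL2_bounded (cmf_ptrig p) hM lg.
Qed.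

Lemma cL2_ptrig p : cL2 mu (ptrig p).
Proof.
rewrite (_ : ptrig p = fun t => ptrig p t * 1).
  by apply: cL2_ptrig_mul; exact: cL2_cst.
by apply/funext => t; rewrite mulr1.
Qed.

Lemma hardy_ptrig_mul p h : hardy h -> hardy (fun t => ptrig p t * h t).
Proof.
move=> [lh h0]; split; first exact: cL2_ptrig_mul.
move=> n n0; rewrite /ncoef; under eq_fun do rewrite -mulrA.
rewrite (cint_ptrig_mul p (cL2_mulX n lh)) big1// => i _.
under eq_fun do rewrite -mulrA -exprD.
by rewrite [cint _ _](h0 (n + i)%N) ?mulr0// addn_gt0 n0.
Qed.

Lemma hardy_cst (c : R[i]) : hardy (fun=> c).
Proof.
split; first exact: cL2_cst.
move=> n n0; rewrite /ncoef cintZ; last by apply: cL2_cL1; exact: cL2_expiX.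
by rewrite cint_expiX// mulr0.
Qed.

Lemma hardy_ptrig p : hardy (ptrig p).
Proof.
rewrite (_ : ptrig p = fun t => ptrig p t * 1).
  by apply: hardy_ptrig_mul; exact: hardy_cst.
by apply/funext => t; rewrite mulr1.
Qed.

(** The difference between [f] and its projection on the closure of the polynomials has no Fourier
    coefficient: those of negative index vanish because both functions are in [hardy], the others by
    orthogonality to the monomials. *)
Lemma ptrig_dense f : hardy f -> exists p : nat -> {poly R[i]},
  nsq mu (fun t => ptrig (p n) t - f t) @[n --> \oo] --> (0 : R).
Proof.
move=> hf; have [lf f0] := hf.
have [] := @cL2_projection _ _ _ mu (range ptrig) f.
- by move=> _ [p _ <-]; exact: cL2_ptrig.
- by exists (ptrig 0); exists 0.
- move=> _ _ c [p _ <-] [q _ <-]; exists (p + c *: q) => //.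
  by apply/funext => t; rewrite /ptrig hornerD hornerZ.
- exact: lf.
move=> s [h [Ss lh sh orth]].
have /choice[p ps] n : exists p, s n = ptrig p by have [p _ <-] := Ss n; exists p.
have hh : hardy h by apply: hardy_closed lh sh => n; rewrite ps; exact: hardy_ptrig.
have [_ h0] := hh.
have lfh : cL2 mu (fun t => f t - h t) by exact: cL2B.
have fh : {ae mu, forall t, f t - h t = 0}.
  apply: fourier_unique => [|n n0|n]; first exact: cL2_cL1.
    have [_] := hardy_lin (-1) hf hh; move=> /(_ n n0); congr (_ = _).
    by congr cint; apply/funext => t; rewrite mulN1r.
  have := orth (ptrig 'X^n) (ex_intro2 _ _ 'X^n I erefl); congr (_ = _).
  by congr cint; apply/funext => t; rewrite /ptrig hornerXn rmorphXn.
exists p; rewrite (_ : (fun n => _) = fun n => nsq mu (fun t => s n t - h t))//.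
apply/funext => n; apply: nsq_ae_eq.
- exact: cmfB (cmf_ptrig _) (cL2_meas lf).
- by rewrite ps; exact: cmfB (cmf_ptrig _) (cL2_meas lh).
- by apply: (ae_imply _ fh) => t /eqP; rewrite subr_eq0 => /eqP ->; rewrite ps.
Qed.

(** Approximating [f] by polynomials reduces this to the stability of [hardy] under multiplication
    by a polynomial, although [f g] itself is only integrable. *)
Lemma cint_hardy_mul f g n : hardy f -> hardy g -> (0 < n)%N ->
  cint mu (fun t => f t * g t * expi t ^+ n) = 0.
Proof.
move=> hf hg n0; have [p pf] := ptrig_dense hf.
have lg := cL2_mulX n (hardy_cL2 hg).
under eq_fun do rewrite -mulrA.
apply: (cvg_dist_unique (cvg_cint_mul (fun m => cL2_ptrig (p m)) (hardy_cL2 hf) lg pf)).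
apply: nearW => m; have [_ /(_ n n0)] := hardy_ptrig_mul (p m) hg.
by rewrite /ncoef; under eq_fun do rewrite -mulrA.
Qed.

Lemma hardy_mul f g : hardy f -> hardy g -> cL2 mu (fun t => f t * g t) ->
  hardy (fun t => f t * g t).
Proof. by move=> hf hg lfg; split => // n n0; exact: cint_hardy_mul. Qed.

Lemma cL2_unimodular_mul J f : cmf (J : measurableTypeR R -> _) ->
  {ae mu, forall t, sqnormc (J t) = 1} -> cL2 mu f ->
  cL2 mu (fun t => J t * f t) /\ nsq mu (fun t => J t * f t) = nsq mu f.
Proof.
move=> mJ J1 [mf rf]; have mJf : cmf (fun t : measurableTypeR R => J t * f t) by exact: cmfM.
have h : {ae mu, forall t, sqnormc (f t) = sqnormc (J t * f t)}.
  by apply: (ae_imply _ J1) => t Jt; rewrite sqnormcM Jt mul1r.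
split; first split => //.
  by apply: rint_ae_eq h rf; exact: measurable_sqnormc.
apply/esym; apply: rintegral_ae_eq h; exact: measurable_sqnormc.
Qed.

(* [O] is cyclic for multiplication by polynomials, i.e. outer. *)
Definition cyclic_vector O := exists q : nat -> {poly R[i]},
  nsq mu (fun t => ptrig (q n) t * O t - 1) @[n --> \oo] --> (0 : R).

(* A limit of polynomials times [O] equal to [1] replaces the division by [O]. *)
Lemma hardy_cyclic_quotient O u f g : cL2 mu O -> cyclic_vector O -> cL2 mu u ->
  hardy f -> hardy g -> {ae mu, forall t, u t * O t = f t * g t} -> hardy u.
Proof.
move=> lO [q qO] lu hf hg uO; split => // n n0.
have lun := cL2_mulX n lu.
have := cvg_cint_mul (fun m => cL2_ptrig_mul (q m) lO) (cL2_cst mu 1) lun qO.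
rewrite (_ : cint mu (fun t => 1 * _) = ncoef u n); last first.
  by congr cint; apply/funext => t; rewrite mul1r.
move=> /cvg_dist_unique; apply; apply: nearW => m.
rewrite -[RHS](cint_hardy_mul (hardy_ptrig_mul (q m) hf) hg n0).
apply: cint_ae_eq.
- by apply: cL1_meas; apply: cL2_mul lun; exact: cL2_ptrig_mul.
- apply: cmfM; last exact: cmf_expiX.
  by apply: cmfM; [exact: cL2_meas (cL2_ptrig_mul _ (hardy_cL2 hf))|exact: cL2_meas (hardy_cL2 hg)].
- apply: (ae_imply _ uO) => t h; rewrite -[ptrig _ _ * f t * g t]mulrA -h; ring.
Qed.

(** The coefficient of index [m] of [z p h] involves only coefficients of [h] of index below [m]:
    multiplication by [z] raises the order of vanishing at the origin. *)
Lemma cint_shift_coef0 h p m : hardy h -> (forall j, (j < m)%N -> fcoef h j = 0) ->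
  cint mu (fun t => ptrig ('X * p) t * h t * (expi t)^* ^+ m) = 0.
Proof.
move=> [lh h0] hm.
have lhm : cL2 mu (fun t => h t * (expi t)^* ^+ m).
  rewrite (_ : (fun _ => _) = fun t => (expi t)^* ^+ m * h t).
    apply: (cL2_bounded (M := 1)) => //; first by apply: cmfX; exact: cmf_expiJ.
    by move=> t; rewrite normcX normc_expiJ expr1n.
  by apply/funext => t; rewrite mulrC.
under eq_fun do rewrite -mulrA.
rewrite cint_ptrig_mul// big1// => -[[|i] /= _] _.
  by rewrite coefXM/= mul0r.
have [im|mi] := leqP i.+1 m.
  rewrite (_ : cint _ _ = fcoef h (m - i.+1)).
    by rewrite hm ?mulr0// -subSn// subSS leq_subr.
  congr cint; apply/funext => t; rewrite -mulrA; congr (_ * _).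
  by rewrite -{1}(subnK im) exprD -mulrA -exprMn [_^* * _]mulrC expi_mulJ expr1n mulr1.
rewrite (_ : cint _ _ = ncoef h (i.+1 - m)).
  by rewrite h0 ?mulr0// subn_gt0.
congr cint; apply/funext => t; rewrite -mulrA; congr (_ * _).
by rewrite -{1}(subnK (ltnW mi)) exprD mulrCA -exprMn [_^* * _]mulrC expi_mulJ expr1n mulr1.
Qed.

(* [J] spans the orthogonal complement of [z M] in the invariant subspace [M]
   generated by [h]; being orthogonal to all [z ^ n J], it has constant modulus. *)
Lemma inner_outer h : hardy h -> ~ {ae mu, forall t, h t = 0} ->
  exists J O, [/\ hardy J, {ae mu, forall t, sqnormc (J t) = 1}, hardy O,
    cyclic_vector O & {ae mu, forall t, h t = J t * O t}].
Proof.
move=> hh hn0; have [lh h0] := hh.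
pose S := range (fun p t => ptrig ('X * p) t * h t).
have [] := @cL2_projection _ _ _ mu S h.
- by move=> _ [p _ <-]; exact: cL2_ptrig_mul.
- by exists (fun t => ptrig ('X * 0) t * h t), 0.
- move=> _ _ c [p _ <-] [q _ <-]; exists (p + c *: q) => //.
  apply/funext => t; rewrite /ptrig mulrDr -scalerAr hornerD hornerZ; ring.
- exact: lh.
move=> s [h1 [Ss lh1 sh1 orth]].
have /choice[p ps] n : exists p, s n = fun t => ptrig ('X * p) t * h t.
  by have [p _ <-] := Ss n; exists p.
have hs n : hardy (s n) by rewrite ps; exact: hardy_ptrig_mul.
have ls n := hardy_cL2 (hs n).
have hh1 : hardy h1 := hardy_closed hs lh1 sh1.
pose J0 (t : R) := h t - h1 t.
have lJ0 : cL2 mu J0 by exact: cL2B.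
have hJ0 : hardy J0.
  rewrite (_ : J0 = fun t => h t + (-1) * h1 t); first exact: hardy_lin.
  by apply/funext => t; rewrite mulN1r.
pose c := nsq mu J0.
have c0 : c != 0.
  apply/eqP => cE; apply: hn0; have J00 := nsq_eq0 lJ0 cE.
  apply: fourier_unique => //; first exact: cL2_cL1.
  (* If [J0] is null, [h] is a limit of the [z p h]; once its coefficients below [m] vanish, the one
     of index [m] does too, so [h] would be null. *)
  elim/ltn_ind => m IH.
  have lem : cL2 mu (fun t => (expi t)^* ^+ m).
    rewrite (_ : (fun _ => _) = fun t => (expi t ^+ m)^*).
      by apply: cL2J; exact: cL2_expiX.
    by apply/funext => t; rewrite rmorphXn.
  have <- : cint mu (fun t => h1 t * (expi t)^* ^+ m) = 0.
    apply: (cvg_dist_unique (cvg_cint_mul ls lh1 lem sh1)).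
    by apply: nearW => n; rewrite ps; exact: (cint_shift_coef0 (p n) hh IH).
  apply: cint_ae_eq; [|exact: cL1_meas (cL2_mul lh1 lem)|].
    exact: cL1_meas (cL2_mul lh lem).
  by apply: (ae_imply _ J00) => t /eqP; rewrite subr_eq0 => /eqP ->.
have cgt0 : 0 < c by rewrite lt_neqAle eq_sym c0 nsq_ge0.
(* [J0] is the limit of [h - s m = (1 - z p) h], and [z^n] times such a function lies in [S] as
   [n > 0], hence is orthogonal to [J0]. *)
have orthJ n : (0 < n)%N -> cint mu (fun t => J0 t * (J0 t * expi t ^+ n)^*) = 0.
  move=> n0; pose a m (t : R) := h t - s m t.
  have la m : cL2 mu (a m) by exact: cL2B.
  have aJ : nsq mu (fun t => (a m t * expi t ^+ n)^* - (J0 t * expi t ^+ n)^*)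
      @[m --> \oo] --> (0 : R).
    rewrite (_ : (fun m => _) = fun m => nsq mu (fun t => s m t - h1 t))//.
    apply/funext => m; apply: eq_Rintegral => t _.
    rewrite -rmorphB sqnormcJ -mulrBl sqnormcM -[sqnormc (_ ^+ _)]sqr_normcE.
    rewrite normc_expiX expr1n mulr1 -sqnormcN; congr sqnormc.
    by rewrite /a /J0; ring.
  under eq_fun do rewrite mulrC.
  apply: (cvg_dist_unique (cvg_cint_mul (fun m => cL2J (cL2_mulX n (la m)))
    (cL2J (cL2_mulX n lJ0)) lJ0 aJ)).
  apply: nearW => m.
  rewrite -[RHS](orth (fun t => ptrig ('X * ('X^(n.-1) * (1 - 'X * p m))) t * h t)).
    congr cint; apply/funext => t; rewrite mulrC; congr (_ * _^*).
    have -> : expi t ^+ n = expi t * expi t ^+ n.-1 by rewrite -exprS prednK.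
    rewrite /a ps /ptrig !hornerM hornerD hornerN hornerM !hornerX hornerXn -polyC1 hornerC.
    by ring.
  by exists ('X^(n.-1) * (1 - 'X * p m)).
have Jc : {ae mu, forall t, sqnormc (J0 t) = c}.
  (* [D] is real, so its coefficients of negative index are conjugate to the positive ones, which
     vanish by [orthJ]; the constant [c] cancels the coefficient of index 0. *)
  pose D (t : R) : R[i] := (sqnormc (J0 t) - c)%:C%C.
  have lD : cL1 mu D.
    split; last exact: rint_cst.
    by apply: rintB; [have [] := lJ0|exact: rint_cst].
  have lJJ : cL1 mu (fun t => J0 t * (J0 t)^*) by apply: cL2_mul => //; exact: cL2J.
  have DE (t : R) : D t = J0 t * (J0 t)^* - c%:C%C by rewrite mulcJE /D rmorphB.
  have D0 n : (0 < n)%N -> fcoef D n = 0.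
    move=> n0; have le : cL1 mu (fun t => (expi t ^+ n)^*).
      by apply: cL1J; apply: cL2_cL1; exact: cL2_expiX.
    rewrite /fcoef (_ : (fun _ => _) = fun t =>
        J0 t * (J0 t * expi t ^+ n)^* - c%:C%C * (expi t ^+ n)^*).
      rewrite cintB; [|by apply: cL2_mul => //; apply: cL2J; exact: cL2_mulX|exact: cL1Z].
      rewrite orthJ// cintZ// cintJ; last by apply: cL2_cL1; exact: cL2_expiX.
      by rewrite cint_expiX// rmorph0 mulr0 subr0.
    by apply/funext => t; rewrite DE rmorphM/= rmorphXn/=; ring.
  have : {ae mu, forall t, D t = 0}.
    apply: (fourier_unique lD) => [n n0|n].
      have lDn : cL1 mu (fun t => D t * (expi t)^* ^+ n).
        apply: (cL1_bounded (M := 1)) => //; first by apply: cmfX; exact: cmf_expiJ.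
        by move=> t; rewrite normcX normc_expiJ expr1n.
      transitivity ((fcoef D n)^*); last by rewrite D0// rmorph0.
      rewrite /fcoef -cintJ//; congr cint; apply/funext => t.
      rewrite rmorphM/= rmorphXn/= conjCK; congr (_ * _).
      by apply: complex_ext; rewrite ?cReJ ?cImJ /= ?oppr0.
    case: n => [|n]; last exact: D0.
    rewrite /fcoef; under eq_fun do rewrite expr0 mulr1.
    apply: complex_ext => /=; last by rewrite rintegral_cst.
    rewrite RintegralB//; [|by have [] := lJ0|exact: rint_cst].
    by rewrite rintegral_cst -/(nsq mu J0) subrr.
  by apply: ae_imply => t [] /eqP; rewrite subr_eq0 => /eqP.
pose d := (Num.sqrt c)^-1.
have d2 : d ^+ 2 * c = 1 by rewrite exprVn sqr_sqrtr ?mulVf// ltW.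
pose J (t : R) := d%:C%C * J0 t.
have sd : sqnormc (d%:C%C : R[i]) = d ^+ 2.
  by rewrite /Defs.sqnormc /= expr0n/= addr0.
have J1 : {ae mu, forall t, sqnormc (J t) = 1}.
  by apply: (ae_imply _ Jc) => t Jt; rewrite sqnormcM Jt sd.
have hJ : hardy J.
  rewrite (_ : J = fun t => 0 + d%:C%C * J0 t).
    by apply: hardy_lin => //; exact: hardy_cst.
  by apply/funext => t; rewrite add0r.
have lJ := hardy_cL2 hJ.
have mJJ := cmfJ (cL2_meas lJ).
have J1' : {ae mu, forall t, sqnormc ((J t)^*) = 1}.
  by apply: (ae_imply _ J1) => t; rewrite sqnormcJ.
(* As [|J| = 1] almost everywhere, this is [h / J]. *)
pose O (t : R) := (J t)^* * h t.
have [lO _] : cL2 mu O /\ nsq mu O = nsq mu h by exact: cL2_unimodular_mul.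
have JJ : {ae mu, forall t, J t * (J t)^* = 1}.
  by apply: (ae_imply _ J1) => t Jt; rewrite mulcJE Jt.
exists J, O; split => //.
- split => // n n0.
  (* Up to conjugation and the factor [d], the coefficient of [O] of index [- n] is the pairing of
     [J0] with [z^n h], an element of [S]. *)
  have := orth (fun t => ptrig ('X * 'X^(n.-1)) t * h t) (ex_intro2 _ _ 'X^(n.-1) I erefl).
  move=> /(congr1 (fun x => d%:C%C * x^*)); rewrite rmorph0 mulr0 => <-.
  rewrite -cintJ -?cintZ.
  + congr cint; apply/funext => t; rewrite /O /J rmorphM/= rmorphM/= conjCK.
    rewrite /ptrig hornerM hornerX hornerXn -exprS prednK//.
    have -> : (d%:C%C)^* = d%:C%C by exact: conjc_real.
    by rewrite -/(J0 t); ring.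
  + by apply: cL1J; apply: cL2_mul => //; apply: cL2J; exact: cL2_ptrig_mul.
  + by apply: cL2_mul => //; apply: cL2J; exact: cL2_ptrig_mul.
(* These polynomials send [h] to [d (h - s n)], which tends to [d J0 = J]; multiplied by the
   conjugate of [J], this says that they send [O] to functions tending to 1. *)
- exists (fun n => d%:C%C *: (1 - 'X * p n)).
  rewrite (_ : (fun n => _) = fun n => d ^+ 2 * nsq mu (fun t => s n t - h1 t)).
    by rewrite -[X in _ --> X](mulr0 (d ^+ 2)); apply: cvgM => //; exact: cvg_cst.
  apply/funext => n; rewrite -sd -nsqZ; last exact: cL2B.
  have lsh := cL2Z d%:C%C (cL2B (ls n) lh1).
  have [_ <-] := cL2_unimodular_mul mJJ J1' lsh.
  rewrite -[LHS]nsqN; apply: nsq_ae_eq.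
  + by apply: cmfN; apply: cmfB; [exact: cL2_meas (cL2_ptrig_mul _ lO)|exact: cmf_cst].
  + exact: cmfM mJJ (cL2_meas lsh).
  + apply: (ae_imply _ JJ) => t h2; rewrite -[X in - (_ - X)]h2 /O ps /ptrig.
    rewrite hornerZ hornerD hornerN hornerM hornerX -polyC1 hornerC.
    move: ((J t)^*) => K; rewrite /J /J0; ring.
- by apply: (ae_imply _ JJ) => t h2; rewrite /O mulrA h2 mul1r.
Qed.

End hardy_space.

(** * Toeplitz kernels *)

Section toeplitz_kernels.
Context {R : realType}.
Local Notation mu := (circle_prob R).
Implicit Types (f g h k u : R -> R[i]).

Lemma H2P f : H2 f <-> hardy f.
Proof. by split; [exact: H2_hardy|exact: hardy_H2]. Qed.

Lemma cL2_Linfty_mul g f : Linfty g -> cL2 mu f -> cL2 mu (fun t => g t * f t).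
Proof.
move=> /Linfty_bounded[mg [M gM]] [mf rf].
have mgf : cmf (fun t : measurableTypeR R => g t * f t) by exact: cmfM.
(* The bound on [g] holds only almost everywhere, whereas domination is required at every point; the
   minimum satisfies it everywhere and agrees with the function almost everywhere. *)
pose v (t : R) := Num.min (sqnormc (g t * f t)) (M ^+ 2 * sqnormc (f t)).
have mM : measurable_fun setT (fun t : measurableTypeR R => M ^+ 2 * sqnormc (f t)).
  exact: rint_meas (rintZ _ rf).
split => //; apply: (@rint_ae_eq _ _ _ mu v).
- exact: measurable_sqnormc.
- apply: (ae_imply _ gM) => t h; rewrite /v min_l//.
  rewrite sqnormcM ler_wpM2r ?sqnormc_ge0// -sqr_normcE.
  by rewrite ler_pXn2r ?nnegrE ?normc_ge0// (le_trans (normc_ge0 _) h).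
- apply: (@rint_le _ _ _ mu _ (fun t => M ^+ 2 * sqnormc (f t))).
  + by apply: measurable_minr => //; exact: measurable_sqnormc.
  + move=> t; rewrite ger0_norm ?ge_min ?lexx ?orbT//.
    by rewrite le_min sqnormc_ge0 mulr_ge0 ?sqr_ge0 ?sqnormc_ge0.
  + exact: rintZ.
Qed.

Lemma innerE u k : inner u k = cint mu (fun t => u t * (k t)^*).
Proof. by []. Qed.

(** [xget] falls back on its default unless a projection exists; [cL2_projection] supplies one,
    whose limit stays in [hardy] because that space is closed. *)
Lemma proj_H2P u : cL2 mu u -> hardy (proj_H2 u) /\
  forall k, hardy k -> inner (fun t => u t - proj_H2 u t) k = 0.
Proof.
move=> lu; suff : exists h, H2 h /\ forall k, H2 k -> inner (fun t => u t - h t) k = 0.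
  move=> /(xgetPex (fun=> 0)) [/H2P h1 h2].
  by split => // k /H2P; exact: h2.
have [] := @cL2_projection _ _ _ mu (@hardy R) u.
- by move=> f; exact: hardy_cL2.
- by exists (fun=> 0); exact: hardy_cst.
- by move=> f g c; exact: hardy_lin.
- exact: lu.
move=> s [h [hs lh sh orth]]; exists h; split.
  by apply/H2P; exact: hardy_closed hs lh sh.
by move=> k /H2P hk; rewrite innerE orth.
Qed.

Lemma ae_zero_proj_H2 u : cL2 mu u ->
  ae_zero (proj_H2 u) <-> forall k, hardy k -> inner u k = 0.
Proof.
move=> lu; have [hp orth] := proj_H2P lu; have lp := hardy_cL2 hp.
have split_inner k : hardy k -> inner u k = inner (proj_H2 u) k.
  move=> hk; apply/eqP; rewrite -subr_eq0 !innerE -cintB; last 2 first.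
  - by apply: cL2_mul => //; apply: cL2J; exact: hardy_cL2.
  - by apply: cL2_mul => //; apply: cL2J; exact: hardy_cL2.
  rewrite -[X in _ == X](orth k hk) innerE; apply/eqP; congr cint.
  by apply/funext => t; rewrite mulrBl.
split=> [p0 k hk|u0].
  rewrite split_inner// innerE -[RHS](cint_cst mu); apply: cint_ae_eq.
  - by apply: cmfM; [exact: cL2_meas lp|apply: cmfJ; exact: cL2_meas (hardy_cL2 hk)].
  - exact: cmf_cst.
  - by apply: (ae_imply _ p0) => t ->; rewrite mul0r.
(* Tested against the projection itself, the orthogonality yields its own square norm. *)
apply: nsq_eq0 => //; have := split_inner _ hp; rewrite u0// innerE.
move=> /(congr1 (@complex.Re R)) /= h; rewrite [RHS]h; apply: eq_Rintegral => t _.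
by rewrite mulcJE.
Qed.

(* [g f] is orthogonal to [H ^ 2] iff it lies in the conjugate of [z H ^ 2]. *)
Lemma ker_toeplitzP g f : Linfty g -> ker_toeplitz g f <->
  hardy f /\ hardy (fun t => (expi t * (g t * f t))^*).
Proof.
move=> lg; split=> [[/H2P hf]|[hf hgf]]; last first.
  split; first exact/H2P.
  have lgf := cL2_Linfty_mul lg (hardy_cL2 hf).
  apply/(ae_zero_proj_H2 lgf) => k hk.
  (* The coefficient of index [- 1] of the product: the extra factor [z] cancels the conjugate [z]
     carried by the function. *)
  have := cint_hardy_mul hgf hk (ltn0Sn 0).
  move=> /(congr1 (fun x => x^*)); rewrite rmorph0 -cintJ.
    move=> <-; rewrite innerE; congr cint; apply/funext => t.
    rewrite expr1 !rmorphM/= !conjCK.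
    rewrite -[LHS]mul1r -(expi_mulJ t); ring.
  exact: cL1_unitX (cL2_mul (hardy_cL2 hgf) (hardy_cL2 hk)) (@cmf_expi R) (@normc_expi R) 1.
have lgf := cL2_Linfty_mul lg (hardy_cL2 hf).
move=> /(ae_zero_proj_H2 lgf) H; split => //; split.
  apply: cL2J; apply: (cL2_bounded (M := 1)) => //; first exact: cmf_expi.
  by move=> t; rewrite normc_expi.
(* Testing against [z^(n-1)] suffices, the missing factor [z] being part of the function. *)
move=> n n0; have := H (ptrig 'X^(n.-1)) (hardy_ptrig _).
move=> /(congr1 (fun x => x^*)); rewrite rmorph0 innerE -cintJ => [ <-|].
  congr cint; apply/funext => t; rewrite /ptrig hornerXn !rmorphM/= conjCK.
  have -> : expi t ^+ n = expi t * expi t ^+ n.-1 by rewrite -exprS prednK.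
  rewrite -[RHS]mul1r -(expi_mulJ t); ring.
by apply: cL2_mul => //; apply: cL2J; exact: cL2_ptrig.
Qed.

(** A nonzero function of [H^2] is nonzero almost everywhere, in the form needed here. With
    [f = J O] and [|J| = 1], [g O = 0]; since 1 is a limit of polynomials times [O], the integral of
    [|g|^2] vanishes. *)
Lemma hardy_ae_eq0 f g : hardy f -> ~ ae_zero f -> Linfty g ->
  {ae mu, forall t, g t * f t = 0} -> ae_zero g.
Proof.
move=> hf fn0 lg gf0.
have [J [ O [hJ J1 hO [q qO] fJO]]] := inner_outer hf fn0.
have lgg : cL2 mu g.
  rewrite (_ : g = fun t => g t * 1); last by apply/funext => t; rewrite mulr1.
  exact: cL2_Linfty_mul lg (cL2_cst _ _).
have lgJ : cL2 mu (fun t => g t * (g t)^*) := cL2_Linfty_mul lg (cL2J lgg).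
apply: (nsq_eq0 lgg).
have gO : {ae mu, forall t, g t * O t = 0}.
  have h := ae_imply2 (fun t => @conj _ _) gf0 fJO.
  apply: (ae_imply2 _ h J1) => t [h1 h2] h3.
  move: h1; rewrite h2 mulrCA => /eqP; rewrite mulf_eq0 => /orP[/eqP J0|/eqP//].
  by move: h3; rewrite J0 -sqr_normcE Normc.normc0 expr0n => /eqP; rewrite eq_sym oner_eq0.
have h : cint mu (fun t => 1 * (g t * (g t)^*)) = 0.
  apply: (cvg_dist_unique (cvg_cint_mul
    (fun m => cL2_ptrig_mul (q m) (hardy_cL2 hO)) (cL2_cst mu 1) lgJ qO)).
  apply: nearW => m; rewrite -[RHS](cint_cst mu); apply: cint_ae_eq.
  - exact: cL1_meas (cL2_mul (cL2_ptrig_mul (q m) (hardy_cL2 hO)) lgJ).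
  - exact: cmf_cst.
  - apply: (ae_imply _ gO) => t h.
    have -> : ptrig (q m) t * O t * (g t * (g t)^*) =
      ptrig (q m) t * (g t)^* * (g t * O t) by ring.
    by rewrite h mulr0.
move: h => /(congr1 (@complex.Re R)) /= h; rewrite -[RHS]h; apply: eq_Rintegral => t _.
by rewrite mul1r mulcJE.
Qed.

End toeplitz_kernels.

Theorem corollary3p4 (R : realType) (g : R -> R[i])
    (g_Linfty : Linfty g) (g_neq0 : ~ ae_zero g)
    (ker_neq0 : ker_toeplitz g <> @zero_space R) :
  exists f : R -> R[i], [/\ H2 f, ~ ae_zero f & is_Kmin f (ker_toeplitz g)].
Proof.
(* A kernel without nonnull element would equal [zero_space]; equality of sets also demands that
   every null function of [L^2] lie in the kernel. *)
have [f0 [kf0 f0n0]] : exists f0, ker_toeplitz g f0 /\ ~ ae_zero f0.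
  apply: contrapT => H; apply: ker_neq0; apply/seteqP; split=> f.
    move=> kf; split; first by have [[]] := kf.
    by apply: contrapT => fn0; apply: H; exists f.
  move=> [/L2P lf f00]; have h0 := @hardy_cst R 0.
  have zf : {ae circle_prob R, forall t, 0 = f t} by apply: (ae_imply _ f00) => t ->.
  apply/ker_toeplitzP => //; split; first exact: hardy_ae_eq (cL2_meas lf) zf h0.
  apply: hardy_ae_eq h0.
    apply: cmfJ; apply: cmfM; first exact: cmf_expi.
    exact: cL2_meas (cL2_Linfty_mul g_Linfty lf).
  by apply: (ae_imply _ f00) => t ->; rewrite !mulr0 rmorph0.
have /(ker_toeplitzP _ g_Linfty)[hf0 hh] := kf0.
pose h (t : R) := (expi t * (g t * f0 t))^*.
have hn0 : ~ {ae circle_prob R, forall t, h t = 0}.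
  move=> h00; apply: g_neq0; apply: (hardy_ae_eq0 hf0 f0n0 g_Linfty).
  apply: (ae_imply _ h00) => t /eqP; rewrite conjC_eq0 mulf_eq0.
  by rewrite (negbTE (expi_neq0 t)) => /eqP.
have [J [ O [hJ J1 hO cO hJO]]] := inner_outer hh hn0.
pose f (t : R) := J t * f0 t.
have [lf nf] : cL2 (circle_prob R) f /\ nsq (circle_prob R) f = nsq (circle_prob R) f0.
  exact: cL2_unimodular_mul (cL2_meas (hardy_cL2 hJ)) J1 (hardy_cL2 hf0).
(* The product stays in [L^2], as [hardy_mul] requires, because [J] is unimodular. *)
have hf : hardy f by exact: hardy_mul.
have lgf := cL2_Linfty_mul g_Linfty lf.
have fO : {ae circle_prob R, forall t, O t = (expi t * (g t * f t))^*}.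
  apply: (ae_imply2 _ hJO J1) => t; rewrite -/(h t) => h1 h2.
  have -> : (expi t * (g t * f t))^* = (J t)^* * h t.
    by rewrite /f /h !rmorphM/=; ring.
  by rewrite h1 mulrA [_^* * _]mulrC mulcJE h2 mul1r.
have mgf : cmf (fun t : measurableTypeR R => (expi t * (g t * f t))^*).
  apply: cmfJ; apply: cmfM; first exact: cmf_expi.
  exact: cL2_meas lgf.
have kf : ker_toeplitz g f.
  by apply/ker_toeplitzP => //; split => //; exact: hardy_ae_eq mgf fO hO.
exists f; split; first exact/H2P.
  move=> f00; apply: f0n0; apply: nsq_eq0; first exact: hardy_cL2.
  rewrite -nf -[RHS](rintegral_cst (circle_prob R)); apply: rintegral_ae_eq.
  - exact: measurable_sqnormc (cL2_meas lf).
  - exact: measurable_cst.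
  - by apply: (ae_imply _ f00) => t ->; rewrite -sqr_normcE Normc.normc0 expr0n.
split => //; first by exists g.
move=> _ [g' g'_Linfty ->] /(ker_toeplitzP _ g'_Linfty)[_ hh'].
move=> f1 /(ker_toeplitzP _ g_Linfty)[hf1 hh1].
apply/(ker_toeplitzP _ g'_Linfty); split => //.
(* The quotient by [O] is already known as an [L^2] function, since [g'] is essentially bounded;
   only its negative coefficients remain to be killed. *)
apply: (hardy_cyclic_quotient (hardy_cL2 hO) cO _ hh' hh1).
  apply: cL2J; apply: (cL2_bounded (M := 1)); first exact: cmf_expi.
    by move=> t; rewrite normc_expi.
  exact: cL2_Linfty_mul g'_Linfty (hardy_cL2 hf1).
by apply: (ae_imply _ fO) => t ->; rewrite -!rmorphM; congr (_^*); ring.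
Qed.
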